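(* Let $M$ be a model of ZFA such that $M\models$ ''the set $A$ of atoms is countably infinite''. In $M$, let $\Sigma=\operatorname{Sym}(A)$ be the group of all bijections of $A$, and let $\mathcal{F}$ be the filter of subgroups of $\Sigma$ generated by the subgroups $\operatorname{Stab}(a)$ for $a\in A$. Then Frucht's Theorem fails in the permutation model $M'=M/\mathcal{F}$ (the Frankel model).
   Context: ZFA is ZF modified to allow a set $A$ of atoms (objects with no elements, distinct from each other and from $\varnothing$; extensionality is restricted to non-atoms). A bijection $\pi$ of $A$ acts on the whole universe by its given action on atoms and, recursively, $\pi[S]=\{\pi[x]\mid x\in S\}$ for sets $S$. For $S\in M$, $\operatorname{Stab}(S)=\{\sigma\in\Sigma\mid \sigma[S]=S\}$. The filter generated by the subgroups $\operatorname{Stab}(a)$ consists of all subgroups of $\Sigma$ containing a finite intersection of such stabilizers; it is a normal filter. An $S\in M$ is symmetric if $\operatorname{Stab}(S)\in\mathcal{F}$, and hereditarily symmetric if $S$ and every element of its transitive closure are symmetric. The permutation model $M/\mathcal{F}$ is the class of hereditarily symmetric elements of $M$; it is a model of ZFA with the same set of atoms. A graph is a pair $\langle V(G),E(G)\rangle$ with $V(G)$ a set and $E(G)\subseteq V(G)^2$ symmetric and irreflexive; its automorphisms are the bijections of $V(G)$ preserving edges and non-edges. Frucht's Theorem is the statement that every group is isomorphic to the automorphism group of some graph. *)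

(* Defs.v *)
(** Structures for the language of set theory with atoms.  Set-theoretic notions
    are written relationally over an arbitrary structure [M]: for a property
    [P M : Prop] below, [P M] unfolds to the assertion that [M] satisfies [P].
    All quantifiers range over [M], so that "finite", "function", "omega", ...
    are the notions internal to [M], which may be nonstandard. *)

Set Implicit Arguments.
Unset Strict Implicit.

Record structure : Type := Structure {
  carrier :> Type;
  mem : carrier -> carrier -> Prop;
  atom : carrier -> Prop
}.

Declare Scope zfa_scope.
Open Scope zfa_scope.

Notation "x ∈ y" := (mem x y) (at level 70, no associativity) : zfa_scope.
Notation "'∀' x ∈ y , P" := (forall x, x ∈ y -> P)
  (at level 200, x name, y at level 9, right associativity) : zfa_scope.
Notation "'∃' x ∈ y , P" := (exists x, x ∈ y /\ P)
  (at level 200, x name, y at level 9, right associativity) : zfa_scope.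

(** First-order formulas with de Bruijn indices, used to state the schemas. *)

Inductive formula : Type :=
| FMem (i j : nat)
| FEq (i j : nat)
| FAtom (i : nat)
| FBot
| FImp (p q : formula)
| FAnd (p q : formula)
| FOr (p q : formula)
| FAll (p : formula)
| FEx (p : formula).

Definition scons {X : Type} (x : X) (e : nat -> X) (n : nat) : X :=
  match n with O => x | S m => e m end.

Fixpoint sat {M : structure} (e : nat -> M) (p : formula) : Prop :=
  match p with
  | FMem i j => e i ∈ e j
  | FEq i j => e i = e j
  | FAtom i => atom (e i)
  | FBot => False
  | FImp p q => sat e p -> sat e q
  | FAnd p q => sat e p /\ sat e q
  | FOr p q => sat e p \/ sat e q
  | FAll p => forall x, sat (scons x e) p
  | FEx p => exists x, sat (scons x e) p
  end.

Definition is_set {M : structure} (x : M) : Prop := ~ atom x.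

Definition subset {M : structure} (x y : M) : Prop := forall z, z ∈ x -> z ∈ y.

Definition is_empty {M : structure} (x : M) : Prop :=
  is_set x /\ forall z, ~ z ∈ x.

Definition is_upair {M : structure} (p x y : M) : Prop :=
  is_set p /\ forall z, z ∈ p <-> z = x \/ z = y.

Definition is_opair {M : structure} (p x y : M) : Prop :=
  exists s d, is_upair s x x /\ is_upair d x y /\ is_upair p s d.

Definition is_succ {M : structure} (s x : M) : Prop :=
  is_set s /\ forall z, z ∈ s <-> z ∈ x \/ z = x.

Definition is_inductive {M : structure} (w : M) : Prop :=
  is_set w /\ (exists e, is_empty e /\ e ∈ w) /\
  ∀ x ∈ w, exists s, is_succ s x /\ s ∈ w.

Definition is_omega {M : structure} (w : M) : Prop :=
  is_inductive w /\ forall v, is_inductive v -> subset w v.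

Definition is_product {M : structure} (p x y : M) : Prop :=
  is_set p /\
  forall t, t ∈ p <-> exists a b, a ∈ x /\ b ∈ y /\ is_opair t a b.

Definition related {M : structure} (r x y : M) : Prop :=
  exists p, is_opair p x y /\ p ∈ r.

Definition is_function {M : structure} (f x y : M) : Prop :=
  is_set f /\
  (∀ t ∈ f, exists a b, a ∈ x /\ b ∈ y /\ is_opair t a b) /\
  ∀ a ∈ x, exists! b, related f a b.

Definition is_bijection {M : structure} (f x y : M) : Prop :=
  is_function f x y /\ ∀ b ∈ y, exists! a, related f a b.

(** [h] is the composition "[f], then [g]". *)
Definition is_comp {M : structure} (h g f : M) : Prop :=
  is_set h /\
  forall t, t ∈ h <->
    exists x y z, related f x y /\ related g y z /\ is_opair t x z.

Definition is_inverse {M : structure} (g f : M) : Prop :=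
  is_set g /\ forall t, t ∈ g <-> exists x y, related f x y /\ is_opair t y x.

Definition is_finite {M : structure} (x : M) : Prop :=
  exists w n f, is_omega w /\ n ∈ w /\ is_bijection f n x.

Definition countably_infinite {M : structure} (x : M) : Prop :=
  exists w f, is_omega w /\ is_bijection f w x.

Definition is_transitive {M : structure} (t : M) : Prop :=
  is_set t /\ ∀ u ∈ t, ∀ v ∈ u, v ∈ t.

Definition is_trans_closure {M : structure} (t x : M) : Prop :=
  is_transitive t /\ subset x t /\
  forall u, is_transitive u -> subset x u -> subset t u.

Definition is_atom_set {M : structure} (A : M) : Prop :=
  is_set A /\ forall x, x ∈ A <-> atom x.

Record is_ZFA (M : structure) : Prop := {
  zfa_atom : forall a : M, atom a -> forall x, ~ x ∈ a;
  zfa_atoms : exists A : M, is_atom_set A;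
  zfa_ext : forall x y : M, is_set x -> is_set y ->
    (forall z, z ∈ x <-> z ∈ y) -> x = y;
  zfa_found : forall x : M, (exists y, y ∈ x) ->
    ∃ y ∈ x, forall z, ~ (z ∈ x /\ z ∈ y);
  zfa_pair : forall x y : M, exists p, is_upair p x y;
  zfa_union : forall x : M, exists u, is_set u /\
    forall z, z ∈ u <-> ∃ y ∈ x, z ∈ y;
  zfa_power : forall x : M, exists p, is_set p /\
    forall z, z ∈ p <-> is_set z /\ subset z x;
  zfa_infinity : exists w : M, is_inductive w;
  zfa_separation : forall (p : formula) (e : nat -> M) (x : M),
    exists y, is_set y /\ forall z, z ∈ y <-> z ∈ x /\ sat (scons z e) p;
  zfa_replacement : forall (p : formula) (e : nat -> M) (x : M),
    (∀ u ∈ x, forall v v',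
       sat (scons u (scons v e)) p -> sat (scons u (scons v' e)) p -> v = v') ->
    exists y, is_set y /\
      forall v, v ∈ y <-> ∃ u ∈ x, sat (scons u (scons v e)) p
}.

Definition is_Sym {M : structure} (S A : M) : Prop :=
  is_set S /\ forall f, f ∈ S <-> is_bijection f A A.

(** [y = pi[x]].  The [∈]-recursion defining the action is carried out inside
    [M]: the values are those of any function of [M] that satisfies the
    recursion clauses on a transitive set containing [x]. *)
Definition acts {M : structure} (pi x y : M) : Prop :=
  exists t Y f,
    is_transitive t /\ x ∈ t /\ is_function f t Y /\
    (forall u v, related f u v -> atom u -> related pi u v) /\
    (forall u v, related f u v -> is_set u ->
       is_set v /\ forall z, z ∈ v <-> ∃ w ∈ u, related f w z) /\
    related f x y.

(** [H = Stab(x)], where [S] is the group of permutations. *)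
Definition is_stab {M : structure} (S H x : M) : Prop :=
  is_set H /\ forall s, s ∈ H <-> s ∈ S /\ acts s x x.

(** [H] is a subgroup of the group [S] of permutations. *)
Definition is_perm_subgroup {M : structure} (S H : M) : Prop :=
  is_set H /\ subset H S /\ (exists f, f ∈ H) /\
  (∀ f ∈ H, ∀ g ∈ H, exists h, is_comp h g f /\ h ∈ H) /\
  ∀ f ∈ H, exists g, is_inverse g f /\ g ∈ H.

(** [F] is the filter of subgroups of [S] generated by the subgroups [Stab(a)],
    [a ∈ A]; for [e] empty the intersection of stabilizers is [S]. *)
Definition is_generated_filter {M : structure} (A S F : M) : Prop :=
  is_set F /\
  forall H, H ∈ F <->
    is_perm_subgroup S H /\
    exists e, is_finite e /\ subset e A /\
      ∀ s ∈ S, (∀ a ∈ e, exists K, is_stab S K a /\ s ∈ K) -> s ∈ H.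

Definition symmetric {M : structure} (S F x : M) : Prop :=
  exists H, is_stab S H x /\ H ∈ F.

Definition hereditarily_symmetric {M : structure} (S F x : M) : Prop :=
  symmetric S F x /\
  exists t, is_trans_closure t x /\ ∀ y ∈ t, symmetric S F y.

Definition permutation_model (M : structure) (S F : M) : structure :=
  {| carrier := {x : M | hereditarily_symmetric S F x};
     mem := fun x y => proj1_sig x ∈ proj1_sig y;
     atom := fun x => atom (proj1_sig x) |}.

Definition is_operation {M : structure} (op G : M) : Prop :=
  exists P, is_product P G G /\ is_function op P G.

Definition op_value {M : structure} (op x y z : M) : Prop :=
  exists p, is_opair p x y /\ related op p z.

Definition is_group {M : structure} (g : M) : Prop :=
  exists G op,
    is_opair g G op /\ is_set G /\ is_operation op G /\
    (∀ x ∈ G, ∀ y ∈ G, ∀ z ∈ G, forall xy yz r,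
       op_value op x y xy -> op_value op y z yz ->
       (op_value op xy z r <-> op_value op x yz r)) /\
    ∃ i ∈ G,
      (∀ x ∈ G, op_value op i x x /\ op_value op x i x) /\
      ∀ x ∈ G, ∃ y ∈ G, op_value op x y i /\ op_value op y x i.

Definition isomorphic {M : structure} (g h : M) : Prop :=
  exists G opG H opH f,
    is_opair g G opG /\ is_opair h H opH /\ is_bijection f G H /\
    ∀ x ∈ G, ∀ y ∈ G, forall z x' y' z',
      op_value opG x y z ->
      related f x x' -> related f y y' -> related f z z' ->
      op_value opH x' y' z'.

Definition graph_on {M : structure} (Gamma V E : M) : Prop :=
  is_opair Gamma V E /\ is_set V /\
  is_set E /\ (∀ t ∈ E, exists x y, x ∈ V /\ y ∈ V /\ is_opair t x y) /\
  (forall x y, related E x y -> related E y x) /\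
  forall x, ~ related E x x.

Definition is_automorphism {M : structure} (f V E : M) : Prop :=
  is_bijection f V V /\
  ∀ x ∈ V, ∀ y ∈ V, forall x' y',
    related f x x' -> related f y y' -> (related E x y <-> related E x' y').

Definition is_aut_group {M : structure} (a V E : M) : Prop :=
  exists H op,
    is_opair a H op /\
    is_set H /\ (forall f, f ∈ H <-> is_automorphism f V E) /\
    is_set op /\
    forall t, t ∈ op <->
      exists g f h p, g ∈ H /\ f ∈ H /\ is_comp h g f /\
        is_opair p g f /\ is_opair t p h.

Definition Frucht (M : structure) : Prop :=
  forall g : M, is_group g ->
    exists Gamma V E a : M,
      graph_on Gamma V E /\ is_aut_group a V E /\ isomorphic g a.

(* Main.v *)
Require Import Defs.
From Stdlib Require Import Classical ClassicalEpsilon ProofIrrelevance.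
From Stdlib Require Import FunctionalExtensionality Arith.

Set Implicit Arguments.
Unset Strict Implicit.
Open Scope zfa_scope.

(** The group that defeats Frucht's theorem is the set of finite sets of atoms under
    symmetric difference.  All of its constituents are fixed by every permutation of the
    atoms, so it belongs to the permutation model ([finite_sets_group_in_model]).

    Suppose that, in the model, it is isomorphic by [phi] to the automorphism group of a graph
    with vertex set [V] and edge set [E].  Some finite set [s] of atoms supports [V], [E] and
    [phi].  Choose distinct atoms a, b, c outside [s].  The transpositions p = (a b) and
    q = (b c) fix [s] pointwise, hence map [V], [E] and [phi] to themselves; acting on vertices,
    they are automorphisms of the graph.  These automorphisms belong to the model, because the
    restriction of p to [V] is supported by [s] together with a and b
    ([transposition_restriction]).  The group is abelian, so they commute: qp and pq act in
    the same way on [V] ([comp_commute]).  Then they act in the same way on every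
    automorphism, which is a set of pairs of vertices, and therefore, as both preserve the
    bijection [phi], on every element of the group.  But qp sends {a} to {c}, whereas pq sends
    it to {b}.

    The rest is the set theory that this argument needs inside [M], which may be nonstandard:
    induction over the membership relation or over finite sets is available only for
    properties defined by formulas with parameters.  A calculus of definable properties
    ([definable]) discharges these side conditions.  The action of a permutation on the
    members of transitive sets is obtained by recursion ([acts_exists]), and equalities between
    composites of actions are
    reduced to their values at atoms ([act_square]).  Finally, a set of members of the model
    belongs to the model as soon as the permutations that fix some finite set of atoms map
    its elements into it ([hs_intro]). *)

(** * Definability with parameters *)

Definition up (r : nat -> nat) (n : nat) : nat :=
  match n with O => O | S m => S (r m) end.

Fixpoint rename (r : nat -> nat) (p : formula) : formula :=
  match p with
  | FMem i j => FMem (r i) (r j)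
  | FEq i j => FEq (r i) (r j)
  | FAtom i => FAtom (r i)
  | FBot => FBot
  | FImp p q => FImp (rename r p) (rename r q)
  | FAnd p q => FAnd (rename r p) (rename r q)
  | FOr p q => FOr (rename r p) (rename r q)
  | FAll p => FAll (rename (up r) p)
  | FEx p => FEx (rename (up r) p)
  end.

Lemma sat_rename (M : structure) (p : formula) :
  forall (r : nat -> nat) (e e' : nat -> M),
    (forall n, e' n = e (r n)) -> (sat e (rename r p) <-> sat e' p).
Proof.
  assert (H : forall r (e e' : nat -> M) x, (forall n, e' n = e (r n)) ->
            forall n, scons x e' n = scons x e (up r n)).
  { intros r e e' x E [|n]; simpl; auto. }
  induction p; intros r e e' E; simpl; rewrite ?E.
  1-4: tauto.
  1-3: rewrite (IHp1 _ _ _ E), (IHp2 _ _ _ E); tauto.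
  - split; intros S x; apply (IHp _ _ _ (H _ _ _ x E)), S.
  - split; intros [x S]; exists x; apply (IHp _ _ _ (H _ _ _ x E)), S.
Qed.

Section Definability.
Variable M : structure.

(** A term is a variable or a parameter from [M]. *)
Definition value (t : nat + M) (e : nat -> M) : M :=
  match t with inl i => e i | inr c => c end.

Definition term (f : (nat -> M) -> M) : Prop := exists t, forall e, f e = value t e.

(** The properties of environments given by a formula with parameters: the formula is evaluated
    under an environment that mixes variables and parameters, so that the closure lemmas never
    have to name the parameters. *)
Definition definable (P : (nat -> M) -> Prop) : Prop :=
  exists (p : formula) (s : nat -> nat + M),
    forall e, sat (fun n => value (s n) e) p <-> P e.

Lemma term_var i : term (fun e => e i).
Proof. exists (inl i); reflexivity. Qed.

Lemma term_const c : term (fun _ => c).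
Proof. exists (inr c); reflexivity. Qed.

Lemma term_rename f (r : nat -> nat) : term f -> term (fun e => f (fun n => e (r n))).
Proof.
  intros [[i|c] H]; [exists (inl (r i)) | exists (inr c)];
    intro e; exact (H (fun n => e (r n))).
Qed.

Lemma definable_rename (r : nat -> nat) (P : (nat -> M) -> Prop) :
  definable P -> definable (fun e => P (fun n => e (r n))).
Proof.
  intros (p & s & H).
  exists p, (fun n => match s n with inl i => inl (r i) | t => t end); intro e.
  rewrite <- H.
  match goal with |- sat ?a _ <-> sat ?b _ => replace a with b; [reflexivity|] end.
  apply functional_extensionality; intro n; destruct (s n); reflexivity.
Qed.

Lemma definable_rename2 (R : M -> M -> Prop) i j :
  definable (fun e => R (e 0) (e 1)) -> definable (fun e => R (e i) (e j)).
Proof. exact (@definable_rename (fun n => match n with 0 => i | _ => j end) _). Qed.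

Lemma definable_rename1 (R : M -> Prop) i :
  definable (fun e => R (e 0)) -> definable (fun e => R (e i)).
Proof. exact (@definable_rename (fun _ => i) _). Qed.

Lemma definable_atomic2 (Q : M -> M -> Prop) p f g :
  (forall e : nat -> M, sat e p <-> Q (e 0) (e 1)) ->
  term f -> term g -> definable (fun e => Q (f e) (g e)).
Proof.
  intros Hp [t Ht] [u Hu].
  exists p, (fun n => match n with O => t | _ => u end); intro e.
  rewrite Hp, Ht, Hu; reflexivity.
Qed.

Lemma definable_mem f g : term f -> term g -> definable (fun e => f e ∈ g e).
Proof. apply (@definable_atomic2 (@mem M) (FMem 0 1)); reflexivity. Qed.

Lemma definable_eq f g : term f -> term g -> definable (fun e => f e = g e).
Proof. apply (@definable_atomic2 (@eq M) (FEq 0 1)); reflexivity. Qed.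

Lemma definable_atom f : term f -> definable (fun e => atom (f e)).
Proof.
  intro H; apply (@definable_atomic2 (fun x _ => atom x) (FAtom 0) f f); auto; reflexivity.
Qed.

Lemma definable_False : definable (fun _ => False).
Proof. exists FBot, (fun n => inl n); reflexivity. Qed.

(** Two formulas use unrelated tables of terms; they are merged by sending the variables of one
    to the even numbers and those of the other to the odd numbers. *)
Lemma definable_binary (k : formula -> formula -> formula) (K : Prop -> Prop -> Prop)
  (P Q : (nat -> M) -> Prop) :
  (forall (e : nat -> M) p q, sat e (k p q) <-> K (sat e p) (sat e q)) ->
  (forall A A' B B', (A <-> A') -> (B <-> B') -> (K A B <-> K A' B')) ->
  definable P -> definable Q -> definable (fun e => K (P e) (Q e)).
Proof.
  intros Hk HK (p & s & Hp) (q & s' & Hq).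
  set (s0 := fun n => if Nat.even n then s (Nat.div2 n) else s' (Nat.div2 n)).
  exists (k (rename (fun n => 2 * n) p) (rename (fun n => S (2 * n)) q)), s0.
  intro e; rewrite Hk; apply HK.
  - rewrite <- Hp; apply sat_rename; intro n; unfold s0.
    rewrite Nat.even_even, Nat.div2_double; reflexivity.
  - rewrite <- Hq; apply sat_rename; intro n; unfold s0.
    rewrite Nat.div2_succ_double, <- Nat.add_1_r, Nat.even_odd; reflexivity.
Qed.

Lemma definable_and P Q : definable P -> definable Q -> definable (fun e => P e /\ Q e).
Proof. apply (@definable_binary FAnd and); simpl; tauto. Qed.

Lemma definable_or P Q : definable P -> definable Q -> definable (fun e => P e \/ Q e).
Proof. apply (@definable_binary FOr or); simpl; tauto. Qed.

Lemma definable_imp (P Q : _ -> Prop) :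
  definable P -> definable Q -> definable (fun e => P e -> Q e).
Proof. apply (@definable_binary FImp (fun A B => A -> B)); simpl; tauto. Qed.

Lemma definable_not P : definable P -> definable (fun e => ~ P e).
Proof. intro H; exact (definable_imp H definable_False). Qed.

Lemma definable_iff P Q : definable P -> definable Q -> definable (fun e => P e <-> Q e).
Proof. intros H K; exact (definable_and (definable_imp H K) (definable_imp K H)). Qed.

(** The new variable has index 0 in the scope of a quantifier, whereas the table of terms may
    refer to it at many places: all these are identified, and the other entries are shifted. *)
Lemma definable_under_binder (Q : (nat -> M) -> M -> Prop) :
  definable (fun e => Q (fun n => e (S n)) (e 0)) ->
  exists p (s : nat -> nat + M), forall e x,
    sat (scons x (fun n => value (s n) e)) p <-> Q e x.
Proof.
  intros (p & s & Hp).
  exists (rename (fun n => match s n with inl O => O | _ => S n end) p),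
    (fun n => match s n with inl (S i) => inl i | t => t end).
  intros e x; rewrite <- (Hp (scons x e)).
  apply sat_rename; intro n; destruct (s n) as [[|i]|c] eqn:E; simpl; rewrite ?E; reflexivity.
Qed.

Lemma definable_ex (Q : (nat -> M) -> M -> Prop) :
  definable (fun e => Q (fun n => e (S n)) (e 0)) -> definable (fun e => exists x, Q e x).
Proof.
  intro H; destruct (definable_under_binder (Q := Q) H) as (p & s & Hp).
  exists (FEx p), s; intro e; simpl; split; intros [x S]; exists x; apply Hp, S.
Qed.

Lemma definable_all (Q : (nat -> M) -> M -> Prop) :
  definable (fun e => Q (fun n => e (S n)) (e 0)) -> definable (fun e => forall x, Q e x).
Proof.
  intro H; destruct (definable_under_binder (Q := Q) H) as (p & s & Hp).
  exists (FAll p), s; intro e; simpl; split; intros S x; apply Hp, S.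
Qed.

End Definability.

(** [dfn] proves that a property written with the connectives, the quantifiers over [M] and
    the set-theoretic relations is definable.  [dfn_lemma] collects the lemmas on defined
    relations, and is extended below. *)
Ltac term_tac :=
  cbv beta; first [ assumption | simple apply term_const | simple apply term_var
    | simple apply term_rename; assumption ].

Ltac dfn_lemma := fail.

Ltac dfn_step :=
  cbv beta;
  first
  [ solve [term_tac] | assumption
  | dfn_lemma
  | simple apply definable_rename1; assumption | simple apply definable_rename2; assumption
  | simple apply definable_mem | simple apply definable_eq | simple apply definable_atom
  | simple apply definable_False
  | simple apply definable_not
  | simple apply definable_iff
  | simple apply definable_and | simple apply definable_or
  | simple apply definable_all | simple apply definable_ex
  | simple apply definable_imp ].

Ltac dfn := repeat dfn_step.
Section DefinableRelations.
Variable M : structure.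
Implicit Types p f w r x y z t : (nat -> M) -> M.

Lemma definable_set x : term x -> definable (fun e => is_set (x e)).
Proof. intros; unfold is_set; dfn. Qed.

Lemma definable_upair p x y : term p -> term x -> term y ->
  definable (fun e => is_upair (p e) (x e) (y e)).
Proof. intros; unfold is_upair, is_set; dfn. Qed.

Lemma definable_opair p x y : term p -> term x -> term y ->
  definable (fun e => is_opair (p e) (x e) (y e)).
Proof.
  intros; unfold is_opair; repeat (dfn; simple apply definable_upair).
Qed.

Lemma definable_related r x y : term r -> term x -> term y ->
  definable (fun e => related (r e) (x e) (y e)).
Proof.
  intros; unfold related; repeat (dfn; simple apply definable_opair).
Qed.

Lemma definable_function f x y : term f -> term x -> term y ->
  definable (fun e => is_function (f e) (x e) (y e)).
Proof.
  intros; unfold is_function, is_set, unique.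
  repeat (dfn; first [simple apply definable_opair | simple apply definable_related]).
Qed.

Lemma definable_bijection f x y : term f -> term x -> term y ->
  definable (fun e => is_bijection (f e) (x e) (y e)).
Proof.
  intros; unfold is_bijection, unique.
  repeat (dfn; first [simple apply definable_function | simple apply definable_related]).
Qed.

Lemma definable_succ x y : term x -> term y ->
  definable (fun e => is_succ (x e) (y e)).
Proof. intros; unfold is_succ, is_set; dfn. Qed.

Lemma definable_omega w : term w -> definable (fun e => is_omega (w e)).
Proof.
  intros; unfold is_omega, is_inductive, is_succ, is_empty, subset, is_set; dfn.
Qed.

Lemma definable_finite x : term x -> definable (fun e => is_finite (x e)).
Proof.
  intros; unfold is_finite.
  repeat (dfn; first [simple apply definable_omega | simple apply definable_bijection]).
Qed.

Lemma definable_transitive t : term t -> definable (fun e => is_transitive (t e)).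
Proof. intros; unfold is_transitive, is_set; dfn. Qed.

Lemma definable_subset x y : term x -> term y ->
  definable (fun e => subset (x e) (y e)).
Proof. intros; unfold subset; dfn. Qed.

Lemma definable_acts p x y : term p -> term x -> term y ->
  definable (fun e => acts (p e) (x e) (y e)).
Proof.
  intros; unfold acts.
  repeat (dfn; first [ simple apply definable_transitive | simple apply definable_function
                     | simple apply definable_related | simple apply definable_set]).
Qed.

End DefinableRelations.

Ltac dfn_lemma ::=
  first [ simple apply definable_opair | simple apply definable_upair
        | simple apply definable_related | simple apply definable_function
        | simple apply definable_bijection | simple apply definable_omega
        | simple apply definable_succ
        | simple apply definable_finite | simple apply definable_transitive
        | simple apply definable_acts | simple apply definable_set
        | simple apply definable_subset ].

(** * Elementary set theory with atoms *)

Section ZFA.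
Variable M : structure.
Hypothesis Z : is_ZFA M.
Implicit Types x y z a b t r f w u v X Y T : M.

(** The two schemas, for definable properties in place of formulas. *)
Lemma separation (Q : M -> Prop) x :
  definable (fun e : nat -> M => Q (e 0)) ->
  exists y, is_set y /\ forall z, z ∈ y <-> z ∈ x /\ Q z.
Proof.
  intros (p & s & H).
  destruct (@definable_under_binder M (fun _ z => Q z)) as (p' & s' & H').
  { exists p, s; exact H. }
  destruct (@zfa_separation M Z p' (fun n => value (s' n) (fun _ => x)) x) as (y & Sy & Hy).
  exists y; split; auto; intro z; rewrite Hy, H'; reflexivity.
Qed.

Lemma replacement (R : M -> M -> Prop) x :
  definable (fun e => R (e 0) (e 1)) ->
  (∀ u ∈ x, forall v v', R u v -> R u v' -> v = v') ->
  exists y, is_set y /\ forall v, v ∈ y <-> ∃ u ∈ x, R u v.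
Proof.
  intros (p & s & H) F.
  set (p' := rename (fun n => match s n with inl 0 => 0 | inl _ => 1 | inr _ => S (S n) end) p).
  set (e' := fun n => value (match s n with inl _ => inr x | t => t end) (fun _ : nat => x)).
  assert (H' : forall u v, sat (scons u (scons v e')) p' <-> R u v).
  { intros u v; rewrite <- (H (fun n => match n with 0 => u | _ => v end)).
    apply sat_rename; intro n; unfold e'; destruct (s n) as [[|i]|c] eqn:E;
      simpl; rewrite ?E; reflexivity. }
  destruct (@zfa_replacement M Z p' e' x) as (y & Sy & Hy).
  { intros u Hu v v' A B; apply (F u Hu); apply H'; assumption. }
  exists y; split; auto; intro v; rewrite Hy; split; intros (u & Hu & A);
    exists u; split; auto; apply H'; assumption.
Qed.

Lemma is_set_of_mem x y : x ∈ y -> is_set y.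
Proof. intros H A; exact (zfa_atom Z A H). Qed.

Lemma set_ext x y : is_set x -> is_set y -> (forall z, z ∈ x <-> z ∈ y) -> x = y.
Proof. apply (zfa_ext Z). Qed.

(** A member of [T] that is minimal among the counterexamples contradicts the hypothesis; the
    counterexamples form a set because the property is definable. *)
Lemma mem_induction T (Q : M -> Prop) :
  definable (fun e => Q (e 0)) -> is_transitive T ->
  (∀ x ∈ T, ((∀ y ∈ x, Q y) -> Q x)) -> ∀ x ∈ T, Q x.
Proof.
  intros D [_ HT] H x Hx; apply NNPP; intro N.
  destruct (@separation (fun z => ~ Q z) T) as (B & _ & HB); [dfn; exact D|].
  destruct (zfa_found Z (x := B)) as (m & Hm & Min).
  { exists x; apply HB; auto. }
  apply HB in Hm as [Hm Nm]; apply Nm, H; auto; intros y Hy; apply NNPP; intro Ny.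
  apply (Min y); split; auto; apply HB; split; auto; exact (HT m Hm y Hy).
Qed.

Lemma no_2cycle x y : x ∈ y -> y ∈ x -> False.
Proof.
  intros A B; destruct (zfa_pair Z x y) as (p & _ & Hp).
  destruct (zfa_found Z (x := p)) as (m & Hm & Min).
  { exists x; apply Hp; auto. }
  apply Hp in Hm as [->| ->].
  - apply (Min y); split; auto; apply Hp; auto.
  - apply (Min x); split; auto; apply Hp; auto.
Qed.

Lemma mem_irrefl x : ~ x ∈ x.
Proof. intro H; exact (no_2cycle H H). Qed.

(** ** Pairs *)

Definition upair x y : M := proj1_sig (constructive_indefinite_description _ (zfa_pair Z x y)).

Lemma upair_spec x y : is_upair (upair x y) x y.
Proof. exact (proj2_sig (constructive_indefinite_description _ (zfa_pair Z x y))). Qed.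

Lemma mem_upair x y z : z ∈ upair x y <-> z = x \/ z = y.
Proof. apply upair_spec. Qed.

Lemma is_set_upair x y : is_set (upair x y).
Proof. apply upair_spec. Qed.

Lemma is_upair_iff p x y : is_upair p x y <-> p = upair x y.
Proof.
  split; [intros [S H] | intros ->; apply upair_spec].
  apply set_ext; auto using is_set_upair; intro z; rewrite H, mem_upair; reflexivity.
Qed.

Lemma upair_inj x y x' y' :
  upair x y = upair x' y' -> x = x' /\ y = y' \/ x = y' /\ y = x'.
Proof.
  intro E.
  assert (H : forall z, z = x \/ z = y <-> z = x' \/ z = y').
  { intro z; rewrite <- !mem_upair, E; reflexivity. }
  destruct (proj1 (H x) (or_introl eq_refl)), (proj1 (H y) (or_intror eq_refl)),
    (proj2 (H x') (or_introl eq_refl)), (proj2 (H y') (or_intror eq_refl)); subst; auto.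
Qed.

Definition opair x y : M := upair (upair x x) (upair x y).

Lemma is_opair_iff p x y : is_opair p x y <-> p = opair x y.
Proof.
  unfold opair; split.
  - intros (s & d & A & B & C); apply is_upair_iff in A, B, C; congruence.
  - intros ->; exists (upair x x), (upair x y); auto using upair_spec.
Qed.

Lemma opair_spec x y : is_opair (opair x y) x y.
Proof. apply is_opair_iff; reflexivity. Qed.

Lemma is_set_opair x y : is_set (opair x y).
Proof. apply is_set_upair. Qed.

Lemma opair_inj x y x' y' : opair x y = opair x' y' -> x = x' /\ y = y'.
Proof.
  intro E; apply upair_inj in E as [[E F]|[E F]]; apply upair_inj in E, F;
    intuition congruence.
Qed.

Lemma related_iff r x y : related r x y <-> opair x y ∈ r.
Proof.
  split; [intros (p & A & B); apply is_opair_iff in A; congruence |].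
  intro H; exists (opair x y); auto using opair_spec.
Qed.

Lemma union2_exists x y : exists u, is_set u /\ forall z, z ∈ u <-> z ∈ x \/ z ∈ y.
Proof.
  destruct (zfa_union Z (upair x y)) as (u & S & H); exists u; split; auto; intro z.
  rewrite H; split.
  - intros (w & A & B); apply mem_upair in A as [->| ->]; auto.
  - intros [A|A]; [exists x|exists y]; rewrite mem_upair; auto.
Qed.

Lemma adjoin_exists x a : exists u, is_set u /\ forall z, z ∈ u <-> z ∈ x \/ z = a.
Proof.
  destruct (union2_exists x (upair a a)) as (u & S & H); exists u; split; auto; intro z.
  rewrite H, mem_upair; tauto.
Qed.

Lemma empty_exists : exists o : M, is_empty o.
Proof.
  destruct (zfa_infinity Z) as (w & _ & (o & H & _) & _); exists o; exact H.
Qed.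

(** ** Relations and functions given by definable conditions *)

(** The ordered pairs in question are sets of subsets of the union of [X] and [Y], so
    separation from an iterated power set applies. *)
Lemma relation_exists (R : M -> M -> Prop) X Y :
  definable (fun e => R (e 0) (e 1)) ->
  exists r, is_set r /\
    forall t, t ∈ r <-> exists x y, x ∈ X /\ y ∈ Y /\ R x y /\ t = opair x y.
Proof.
  intro D.
  destruct (union2_exists X Y) as (U & _ & HU).
  destruct (zfa_power Z U) as (P & _ & HP); destruct (zfa_power Z P) as (PP & _ & HPP).
  destruct (@separation (fun t => exists x y, x ∈ X /\ y ∈ Y /\ R x y /\ is_opair t x y) PP)
    as (r & S & Hr).
  { dfn. }
  exists r; split; auto; intro t; rewrite Hr; split.
  - intros (_ & x & y & A & B & C & E); apply is_opair_iff in E; exists x, y; auto.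
  - intros (x & y & A & B & C & ->); split; [|exists x, y; auto using opair_spec].
    assert (forall u v, u ∈ U -> v ∈ U -> upair u v ∈ P).
    { intros u v Hu Hv; apply HP; split; [apply is_set_upair|].
      intros z Hz; apply mem_upair in Hz as [->| ->]; auto. }
    apply HPP; split; [apply is_set_opair|].
    intros z Hz; apply mem_upair in Hz as [->| ->]; apply H; apply HU; auto.
Qed.
Lemma related_mem f X Y x y :
  is_function f X Y -> related f x y -> x ∈ X /\ y ∈ Y.
Proof.
  intros (_ & H & _) R; apply related_iff in R.
  destruct (H _ R) as (a & b & A & B & E); apply is_opair_iff, opair_inj in E as [-> ->]; auto.
Qed.

Lemma related_dom f X Y x y : is_function f X Y -> related f x y -> x ∈ X.
Proof. intros F R; apply (related_mem F R). Qed.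

Lemma related_cod f X Y x y : is_function f X Y -> related f x y -> y ∈ Y.
Proof. intros F R; apply (related_mem F R). Qed.

Lemma function_total f X Y x : is_function f X Y -> x ∈ X -> exists y, related f x y.
Proof. intros (_ & _ & H) A; destruct (H x A) as (y & B & _); exists y; exact B. Qed.

Lemma function_fun f X Y x y y' :
  is_function f X Y -> related f x y -> related f x y' -> y = y'.
Proof.
  intros F A B; destruct (related_mem F A) as [Hx _]; destruct F as (_ & _ & H).
  destruct (H x Hx) as (c & _ & U); rewrite <- (U y A), <- (U y' B); reflexivity.
Qed.

Lemma bijection_surj f X Y y : is_bijection f X Y -> y ∈ Y -> exists x, related f x y.
Proof. intros (_ & H) A; destruct (H y A) as (x & B & _); exists x; exact B. Qed.

Lemma bijection_inj f X Y x x' y :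
  is_bijection f X Y -> related f x y -> related f x' y -> x = x'.
Proof.
  intros [F H] A B; destruct (related_mem F A) as [_ Hy].
  destruct (H y Hy) as (c & _ & U); rewrite <- (U x A), <- (U x' B); reflexivity.
Qed.

Lemma function_exists (R : M -> M -> Prop) X Y :
  definable (fun e => R (e 0) (e 1)) ->
  (∀ x ∈ X, ∃ y ∈ Y, R x y) ->
  (∀ x ∈ X, forall y y', y ∈ Y -> y' ∈ Y -> R x y -> R x y' -> y = y') ->
  exists f, is_function f X Y /\
    forall x y, related f x y <-> x ∈ X /\ y ∈ Y /\ R x y.
Proof.
  intros D T F; destruct (@relation_exists R X Y D) as (f & S & H).
  assert (E : forall x y, related f x y <-> x ∈ X /\ y ∈ Y /\ R x y).
  { intros x y; rewrite related_iff, H; split.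
    - intros (a & b & A & B & C & E); apply opair_inj in E as [-> ->]; auto.
    - intros (A & B & C); exists x, y; auto. }
  exists f; split; auto; split; [|split]; auto.
  - intros t Ht; apply H in Ht as (a & b & A & B & _ & ->); exists a, b; auto using opair_spec.
  - intros a Ha; destruct (T a Ha) as (b & B & C); exists b; split; [apply E; auto|].
    intros b' Hb'; apply E in Hb' as (_ & B' & C'); eapply F; eauto.
Qed.

Lemma bijection_exists (R : M -> M -> Prop) X Y :
  definable (fun e => R (e 0) (e 1)) ->
  (∀ x ∈ X, ∃ y ∈ Y, R x y) ->
  (∀ x ∈ X, forall y y', y ∈ Y -> y' ∈ Y -> R x y -> R x y' -> y = y') ->
  (∀ y ∈ Y, ∃ x ∈ X, R x y) ->
  (∀ y ∈ Y, forall x x', x ∈ X -> x' ∈ X -> R x y -> R x' y -> x = x') ->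
  exists f, is_bijection f X Y /\
    forall x y, related f x y <-> x ∈ X /\ y ∈ Y /\ R x y.
Proof.
  intros D T F S I; destruct (function_exists D T F) as (f & Hf & E).
  exists f; split; auto; split; auto.
  intros b Hb; destruct (S b Hb) as (a & A & C); exists a; split; [apply E; auto|].
  intros a' Ha'; apply E in Ha' as (A' & _ & C'); eapply I; eauto.
Qed.

(** * Finiteness *)

Lemma empty_unique (o o' : M) : is_empty o -> is_empty o' -> o = o'.
Proof. intros [A B] [C D]; apply set_ext; auto; firstorder. Qed.

Lemma succ_unique (s s' n : M) : is_succ s n -> is_succ s' n -> s = s'.
Proof. intros [A B] [C D]; apply set_ext; auto; intro z; rewrite B, D; tauto. Qed.

(** If n and m had the same successor without being equal, each would be a member of the
    other. *)
Lemma succ_inj (s n m : M) : is_succ s n -> is_succ s m -> n = m.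
Proof.
  intros [_ A] [_ B].
  destruct (proj1 (B n) (proj2 (A n) (or_intror eq_refl))); auto.
  destruct (proj1 (A m) (proj2 (B m) (or_intror eq_refl))); auto.
  destruct (@no_2cycle n m); auto.
Qed.

Lemma omega_induction w (Q : M -> Prop) :
  is_omega w -> definable (fun e => Q (e 0)) ->
  (forall o, is_empty o -> Q o) -> (∀ n ∈ w, (Q n -> forall s, is_succ s n -> Q s)) ->
  ∀ n ∈ w, Q n.
Proof.
  intros [(S & (o & Ho & Oo) & I) Min] D H0 HS n Hn.
  destruct (@separation Q w D) as (v & Sv & Hv).
  apply (Hv n), (Min v); auto; split; [|split]; auto.
  - exists o; split; auto; apply Hv; auto.
  - intros m Hm; apply Hv in Hm as [Hm Qm]; destruct (I m Hm) as (s & Hs & Ws).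
    exists s; split; auto; apply Hv; split; auto; exact (HS m Hm Qm s Hs).
Qed.

Lemma omega_exists : exists w : M, is_omega w.
Proof.
  destruct (zfa_infinity Z) as (I & HI).
  destruct (@separation (fun z => forall v, is_inductive v -> z ∈ v) I) as (w & Sw & Hw).
  { unfold is_inductive, is_empty; dfn. }
  exists w; split; [split; [|split]|]; auto.
  - destruct HI as (_ & (o & Ho & Io) & _); exists o; split; auto; apply Hw; split; auto.
    intros v (_ & (o' & Ho' & Vo') & _); rewrite (empty_unique Ho Ho'); auto.
  - intros x Hx; apply Hw in Hx as [Ix Hx]; destruct HI as (_ & _ & HI).
    destruct (HI x Ix) as (s & Hs & Is); exists s; split; auto; apply Hw; split; auto.
    intros v Hv; destruct (Hv) as (_ & _ & Iv); destruct (Iv x (Hx v Hv)) as (s' & Hs' & Vs').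
    rewrite (succ_unique Hs Hs'); auto.
  - intros v Hv z Hz; apply Hw in Hz as [_ Hz]; auto.
Qed.

Lemma finite_empty x : (forall z, ~ z ∈ x) -> is_finite x.
Proof.
  intro E; destruct omega_exists as (w & Hw).
  pose proof Hw as [(_ & (o & Ho & Wo) & _) _].
  destruct (@bijection_exists (fun _ _ => False) o x) as (f & Hf & _);
    try solve [dfn | intros ? ?; exfalso; firstorder].
  exists w, o, f; auto.
Qed.

Lemma finite_adjoin x y a :
  is_finite x -> is_set y -> (forall z, z ∈ y <-> z ∈ x \/ z = a) -> is_finite y.
Proof.
  intros (w & n & f & Hw & Hn & Hf) S H.
  destruct (classic (a ∈ x)) as [Ha|Ha].
  { replace y with x; [exists w, n, f; auto|].
    apply set_ext; eauto using is_set_of_mem.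
    intro z; rewrite H; split; [auto|intros [A| ->]; auto]. }
  pose proof Hw as [(_ & _ & I) _]; destruct (I n Hn) as (s & [Ss Hs] & Ws).
  destruct (@bijection_exists (fun i b => related f i b \/ i = n /\ b = a) s y) as (g & Hg & _).
  - dfn.
  - intros i Hi; apply Hs in Hi as [Hi| ->]; [|exists a; rewrite H; auto].
    destruct (function_total (proj1 Hf) Hi) as (b & Hb); exists b; rewrite H.
    split; auto; left; eapply related_cod; eauto; apply Hf.
  - intros i _ b b' _ _ [A|[-> ->]] [B|[E ->]]; auto.
    + eapply function_fun; eauto; apply Hf.
    + subst; destruct (related_mem (proj1 Hf) A); destruct (@mem_irrefl n); auto.
    + destruct (related_mem (proj1 Hf) B); destruct (@mem_irrefl n); auto.
  - intros b Hb; apply H in Hb as [Hb| ->]; [|exists n; rewrite Hs; auto].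
    destruct (bijection_surj Hf Hb) as (i & Hi); exists i; rewrite Hs.
    split; auto; left; eapply related_dom; eauto; apply Hf.
  - intros b _ i i' _ _ [A|[-> ->]] [B|[E E']]; subst; auto.
    + eapply bijection_inj; eauto.
    + destruct (related_mem (proj1 Hf) A); contradiction.
    + destruct (related_mem (proj1 Hf) B); contradiction.
  - exists w, s, g; auto.
Qed.

(** Induction on the size n: if x has size n + 1, remove the element with number n. *)
Lemma finite_induction (Q : M -> Prop) :
  definable (fun e => Q (e 0)) ->
  (forall x, (forall z, ~ z ∈ x) -> Q x) ->
  (forall x y a, is_finite x -> Q x -> (forall z, z ∈ y <-> z ∈ x \/ z = a) -> Q y) ->
  forall x, is_finite x -> Q x.
Proof.
  intros D H0 HS x (w & n & f & Hw & Hn & Hf).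
  enough (forall x f, is_bijection f n x -> Q x) by eauto.
  clear x f Hf; revert n Hn;
  apply (@omega_induction w (fun n => forall x f, is_bijection f n x -> Q x)); auto.
  - dfn.
  - intros o [_ Ho] x f Hf; apply H0; intros z Hz.
    destruct (bijection_surj Hf Hz) as (i & Hi).
    destruct (related_mem (proj1 Hf) Hi); firstorder.
  - intros n Hn IH s [Ss Hs] x f Hf.
    assert (Hns : n ∈ s) by (apply Hs; auto).
    destruct (function_total (proj1 Hf) Hns) as (b & Hb).
    destruct (@separation (fun z => z <> b) x) as (x' & Sx' & Hx'); [dfn|].
    destruct (@bijection_exists (fun i c => related f i c) n x') as (g & Hg & _).
    + dfn.
    + intros i Hi; destruct (function_total (proj1 Hf) (x := i)) as (c & Hc).
      { apply Hs; auto. }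
      exists c; split; auto; apply Hx'; split; [eapply related_cod; eauto; apply Hf|].
      intros ->; rewrite (bijection_inj Hf Hc Hb) in Hi; exact (mem_irrefl Hi).
    + intros i _ c c' _ _ A B; eapply function_fun; eauto; apply Hf.
    + intros c Hc; apply Hx' in Hc as [Hc Ne]; destruct (bijection_surj Hf Hc) as (i & Hi).
      exists i; split; auto.
      destruct (related_mem (proj1 Hf) Hi) as [Si _]; apply Hs in Si as [Si| ->]; auto.
      destruct Ne; eapply function_fun; eauto; apply Hf.
    + intros c _ i i' _ _ A B; eapply bijection_inj; eauto.
    + apply (HS x' x b).
      * exists w, n, g; auto.
      * exact (IH x' g Hg).
      * intro z; rewrite Hx'; split.
        -- intro A; destruct (classic (z = b)); auto.
        -- intros [[A _]| ->]; auto; eapply related_cod; eauto; apply Hf.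
Qed.

(** The relation may be partial, so that this lemma also covers subsets of finite sets. *)
Lemma finite_image (R : M -> M -> Prop) x y :
  definable (fun e => R (e 0) (e 1)) -> (forall u v v', R u v -> R u v' -> v = v') ->
  is_finite x -> is_set y -> (forall z, z ∈ y <-> ∃ u ∈ x, R u z) -> is_finite y.
Proof.
  intros D F Fx; revert x Fx y.
  apply (@finite_induction (fun x => forall y, is_set y ->
    (forall z, z ∈ y <-> ∃ u ∈ x, R u z) -> is_finite y)).
  - dfn.
  - intros x E y S H; apply finite_empty; intros z Hz; apply H in Hz; firstorder.
  - intros x x' a _ IH Hx' y S H.
    destruct (@separation (fun z => ∃ u ∈ x, R u z) y) as (y0 & S0 & H0); [dfn|].
    assert (F0 : is_finite y0).
    { apply IH; auto; intro z; rewrite H0, H; split; [tauto|].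
      intros (u & A & B); split; exists u; rewrite ?Hx'; auto. }
    destruct (classic (exists b, R a b)) as [[b Hb]|N].
    + apply (@finite_adjoin y0 y b); auto; intro z; rewrite H0, H; split.
      * intros (u & A & B); apply Hx' in A as [A| ->]; [left; split|right]; eauto.
        exists u; rewrite Hx'; auto.
      * intros [[A _]| ->]; auto; exists a; rewrite Hx'; auto.
    + replace y with y0; auto; apply set_ext; auto; intro z; rewrite H0, H; split; [tauto|].
      intros (u & A & B); apply Hx' in A as A'; destruct A' as [A'| ->]; [|destruct N; eauto].
      split; exists u; auto.
Qed.

Lemma finite_subset x y : is_finite x -> is_set y -> subset y x -> is_finite y.
Proof.
  intros F S H; apply (@finite_image (fun u v => u = v /\ v ∈ y) x y); auto.
  - dfn.
  - intros u v v' [-> _] [-> _]; auto.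
  - intro z; split; [intro A; exists z; auto | intros (u & _ & -> & A); auto].
Qed.

Lemma finite_union x y u :
  is_finite x -> is_finite y -> is_set u -> (forall z, z ∈ u <-> z ∈ x \/ z ∈ y) ->
  is_finite u.
Proof.
  intros Fx Fy; revert y Fy u.
  apply (@finite_induction (fun y => forall u, is_set u ->
    (forall z, z ∈ u <-> z ∈ x \/ z ∈ y) -> is_finite u)).
  - dfn.
  - intros y E u S H; apply (finite_subset Fx); auto.
    intros z Hz; apply H in Hz; firstorder.
  - intros y y' a _ IH Hy' u S H.
    destruct (union2_exists x y) as (u0 & S0 & H0).
    apply (@finite_adjoin u0 u a); auto; intro z; rewrite H, H0, Hy'; tauto.
Qed.

Lemma finite_adjoin_exists x a : is_finite x ->
  exists y, is_set y /\ is_finite y /\ forall z, z ∈ y <-> z ∈ x \/ z = a.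
Proof.
  intro F; destruct (adjoin_exists x a) as (y & S & H); exists y.
  split; [|split]; auto; eapply finite_adjoin; eauto.
Qed.

(** Suppose that [r] is such a relation between omega and the set obtained from x by adding
    [a].  Shifting [r] by one yields a relation into x in which 0 has become available: wherever
    the shifted relation would take the value [a], use a value at 0 instead.  That value is in
    x, because only one number is related to [a].  Multivalued relations
    spare a choice of values in this step. *)
Lemma omega_not_finite w x : is_omega w -> is_finite x ->
  ~ exists r, (∀ n ∈ w, exists a, a ∈ x /\ related r n a) /\
      (∀ n ∈ w, ∀ m ∈ w, forall a, related r n a -> related r m a -> n = m).
Proof.
  intros Hw; revert x.
  pose proof Hw as [(_ & (o & Ho & Wo) & I) _].
  apply finite_induction; [dfn | | ].
  - intros x E (r & T & _); destruct (T o Wo) as (a & A & _); firstorder.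
  - intros x y a _ IH Hy (r & T & J); apply IH.
    assert (N0 : forall n s, is_succ s n -> s <> o).
    { intros n s [_ Hs] ->; destruct Ho as [_ Ho]; apply (Ho n), Hs; auto. }
    destruct (@relation_exists (fun n b => exists s, is_succ s n /\
        (related r s b \/ related r s a /\ related r o b)) w x) as (r' & S & Hr'); [dfn|].
    assert (Hr : forall n b, related r' n b <-> n ∈ w /\ b ∈ x /\ exists s, is_succ s n /\
        (related r s b \/ related r s a /\ related r o b)).
    { intros n b; rewrite related_iff, Hr'; split.
      - intros (n' & b' & A & B & C & E); apply opair_inj in E as [-> ->]; auto.
      - intros (A & B & C); exists n, b; auto. }
    exists r'; split.
    + intros n Hn; destruct (I n Hn) as (s & Hs & Ws).
      destruct (T s Ws) as (b & B & C); apply Hy in B as [B| ->].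
      { exists b; split; auto; apply Hr; split; [|split]; auto; exists s; auto. }
      destruct (T o Wo) as (b & B & C'); apply Hy in B as [B| ->].
      { exists b; split; auto; apply Hr; split; [|split]; auto; exists s; auto. }
      destruct (N0 n s Hs); eauto.
    + intros n Hn m Hm b A B.
      apply Hr in A as (_ & _ & s & Hs & A), B as (_ & _ & s' & Hs' & B).
      assert (Ws : s ∈ w).
      { destruct (I n Hn) as (t & Ht & Wt); rewrite (succ_unique Hs Ht); auto. }
      assert (Ws' : s' ∈ w).
      { destruct (I m Hm) as (t & Ht & Wt); rewrite (succ_unique Hs' Ht); auto. }
      assert (s = s').
      { destruct A as [A|[A A']], B as [B|[B B']].
        - exact (J s Ws s' Ws' b A B).
        - destruct (N0 n s Hs); eauto.
        - destruct (N0 m s' Hs'); eauto.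
        - exact (J s Ws s' Ws' a A B). }
      subst s'; eapply succ_inj; eauto.
Qed.

Lemma countably_infinite_fresh X x : countably_infinite X -> is_finite x ->
  ∃ a ∈ X, ~ a ∈ x.
Proof.
  intros (w & f & Hw & Hf) Fx; apply NNPP; intro N.
  apply (omega_not_finite Hw Fx); exists f; split.
  - intros n Hn; destruct (function_total (proj1 Hf) Hn) as (a & Ha).
    exists a; split; auto; apply NNPP; intro A; apply N; exists a; split; auto.
    eapply related_cod; eauto; apply Hf.
  - intros n _ m _ a; apply (bijection_inj Hf).
Qed.

End ZFA.

(** * The action of the permutations of the atoms *)

Section Action.
Variable M : structure.
Hypothesis Z : is_ZFA M.
Variables A Sigma : M.
Hypothesis HA : is_atom_set A.
Hypothesis HSigma : is_Sym Sigma A.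
Implicit Types p q f g h x y z a b t w u v X Y T : M.

(** Transitive closures are not constructed in general, since all objects that matter here
    belong to some transitive set; these objects are the domain of the action. *)
Definition ranked x : Prop := exists T, is_transitive T /\ x ∈ T.

Lemma ranked_mem x y : ranked x -> y ∈ x -> ranked y.
Proof. intros (T & (S & HT) & Hx) Hy; exists T; split; [split|]; auto; exact (HT x Hx y Hy). Qed.

Lemma ranked_atom a : atom a -> ranked a.
Proof.
  intro Ha; exists (upair Z a a); split; [split|].
  - apply is_set_upair.
  - intros u Hu v Hv; apply mem_upair in Hu as [-> | ->]; destruct (zfa_atom Z Ha Hv).
  - apply mem_upair; auto.
Qed.

Lemma ranked_induction (Q : M -> Prop) :
  definable (fun e => Q (e 0)) ->
  (forall x, ranked x -> (∀ y ∈ x, Q y) -> Q x) -> forall x, ranked x -> Q x.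
Proof.
  intros D H x (T & HT & Hx); revert x Hx; apply (mem_induction Z D HT).
  intros x Hx; apply H; exists T; auto.
Qed.

Lemma perm_bijection p : p ∈ Sigma -> is_bijection p A A.
Proof. apply HSigma. Qed.

Lemma perm_total p a : p ∈ Sigma -> atom a -> exists b, related p a b.
Proof.
  intros Hp Ha; apply (function_total (proj1 (perm_bijection Hp))), HA, Ha.
Qed.

Lemma perm_fun p a b b' : p ∈ Sigma -> related p a b -> related p a b' -> b = b'.
Proof. intro Hp; apply (function_fun Z (proj1 (perm_bijection Hp))). Qed.

Lemma perm_atom_cod p a b : p ∈ Sigma -> related p a b -> atom b.
Proof. intros Hp R; apply HA, (related_cod Z (proj1 (perm_bijection Hp)) R). Qed.

Lemma acts_ranked p x y : acts p x y -> ranked x.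
Proof. intros (t & _ & _ & Ht & Hx & _); exists t; auto. Qed.

Lemma acts_atom p x y : acts p x y -> atom x -> related p x y.
Proof. intros (t & Y & f & _ & _ & _ & H & _ & R); exact (H x y R). Qed.

(** The images of elements are not yet known to be unique, so the recursion clause takes this
    weaker, two-sided form; it suffices for [acts_unique]. *)
Lemma acts_set p x y : acts p x y -> is_set x ->
  is_set y /\ (∀ w ∈ x, exists z, z ∈ y /\ acts p w z) /\ (∀ z ∈ y, ∃ w ∈ x, acts p w z).
Proof.
  intros (t & Y & f & Ht & Hx & Hf & C & D & R) Sx.
  destruct (D x y R Sx) as [Sy H].
  assert (E : forall w z, w ∈ x -> related f w z -> acts p w z).
  { intros w z Hw Rw; exists t, Y, f; repeat (split; auto); try apply Ht; try apply Hf.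
    exact (proj2 Ht x Hx w Hw). }
  split; [|split]; auto.
  - intros w Hw; destruct (function_total Hf (proj2 Ht x Hx w Hw)) as (z & Hz).
    exists z; split; eauto; apply H; eauto.
  - intros z Hz; apply H in Hz as (w & Hw & Rw); eauto.
Qed.

(** The range of a function that satisfies the recursion clauses on a transitive set is
    transitive. *)
Lemma acts_ranked_value p x y : p ∈ Sigma -> acts p x y -> ranked y.
Proof.
  intros Hp (t & Y & f & Ht & Hx & Hf & C & D & R).
  destruct (@separation M Z (fun v => exists u, related f u v) Y) as (T & ST & HT); [dfn|].
  assert (E : forall v, v ∈ T <-> exists u, related f u v).
  { intro v; rewrite HT; split; [tauto|]; intros (u & Ru); split; eauto.
    eapply related_cod; eauto. }
  exists T; split; [split|]; auto; [|apply E; eauto].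
  intros v Hv z Hz; apply E in Hv as (u & Ru); apply E.
  destruct (classic (atom u)) as [Au|Su].
  - destruct (zfa_atom Z (perm_atom_cod Hp (C u v Ru Au)) Hz).
  - apply (D u v Ru Su) in Hz as (w & _ & Rw); eauto.
Qed.

Lemma acts_unique p x y y' : p ∈ Sigma -> acts p x y -> acts p x y' -> y = y'.
Proof.
  intros Hp H; pose proof (acts_ranked H) as Rx; revert y y' H; revert x Rx.
  apply (@ranked_induction (fun x => forall y y', acts p x y -> acts p x y' -> y = y')); [dfn|].
  intros x _ IH y y' B C; destruct (classic (atom x)) as [Ax|Sx].
  - apply (perm_fun (p := p) (a := x)); auto using acts_atom.
  - destruct (acts_set B Sx) as (Sy & T & I), (acts_set C Sx) as (Sy' & T' & I').
    apply (set_ext Z); auto; intro z; split; intro Hz.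
    + destruct (I z Hz) as (w & Hw & Bw), (T' w Hw) as (z' & Hz' & Cw).
      rewrite (IH w Hw z z'); auto.
    + destruct (I' z Hz) as (w & Hw & Cw), (T w Hw) as (z' & Hz' & Bw).
      rewrite (IH w Hw z z'); auto.
Qed.

(** Let [T] be a transitive set that contains x, and [B] the set of its members at which the
    recursion has a value.  [B] is transitive, and by uniqueness the values form a single
    function on it.  By the induction hypothesis the elements of x are in [B], so the function
    extends to x. *)
Lemma acts_exists p x : p ∈ Sigma -> ranked x -> exists y, acts p x y.
Proof.
  intros Hp; revert x.
  apply (@ranked_induction (fun x => exists y, acts p x y)); [dfn|].
  intros x (T & HT & HxT) IH.
  destruct (@separation M Z (fun u => exists v, acts p u v) T) as (B & SB & HB); [dfn|].
  destruct (@replacement M Z (fun u v => acts p u v) B) as (Y & SY & HY).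
  { dfn. }
  { intros u _ v v'; apply acts_unique; auto. }
  assert (EB : forall u, u ∈ x -> u ∈ B).
  { intros u Hu; apply HB; split; auto; exact (proj2 HT x HxT u Hu). }
  (* The value at x that the recursion prescribes. *)
  assert (exists y, (atom x -> related p x y) /\
      (is_set x -> is_set y /\ forall z, z ∈ y <-> ∃ w ∈ x, acts p w z)) as (y & Ya & Ys).
  { destruct (classic (atom x)) as [Ax|Sx].
    - destruct (perm_total Hp Ax) as (y & Hy); exists y; split; [auto|intro; contradiction].
    - destruct (@replacement M Z (fun u v => acts p u v) x) as (y & Sy & Hy).
      { dfn. }
      { intros u _ v v'; apply acts_unique; auto. }
      exists y; split; [intro; contradiction|auto]. }
  destruct (adjoin_exists Z B x) as (t & St & Ht), (adjoin_exists Z Y y) as (Y' & SY' & HY').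
  assert (Ey : forall y', acts p x y' -> y' = y).
  { intros y' H; destruct (classic (atom x)) as [Ax|Sx].
    - apply (perm_fun (p := p) (a := x)); auto using acts_atom.
    - destruct (acts_set H Sx) as (Sy' & Tw & I), (Ys Sx) as (Sy & Hy).
      apply (set_ext Z); auto; intro z; rewrite Hy; split; [apply I|].
      intros (w & Hw & Hz); destruct (Tw w Hw) as (z' & Hz' & H').
      rewrite (acts_unique Hp Hz H'); exact Hz'. }
  destruct (@function_exists M Z (fun u v => acts p u v \/ u = x /\ v = y) t Y')
    as (f & Ff & Hf).
  { dfn. }
  { intros u Hu; apply Ht in Hu as [Hu| ->].
    - pose proof Hu as Hu'; apply HB in Hu' as (_ & v & Hv); exists v; split; auto.
      apply HY'; left; apply HY; eauto.
    - exists y; split; auto; apply HY'; auto. }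
  { intros u _ v v' _ _ [H|[-> ->]] [H'|[E ->]]; subst; auto.
    - exact (acts_unique Hp H H').
    - symmetry; auto. }
  assert (Hf' : forall u v, u ∈ t -> (related f u v <-> acts p u v \/ u = x /\ v = y)).
  { intros u v Hu; rewrite Hf; split; [tauto|]; intro H; split; [|split]; auto.
    apply HY'; destruct H as [H|[_ ->]]; auto; apply Ht in Hu as [Hu| ->]; auto.
    left; apply HY; eauto. }
  assert (Tt : is_transitive t).
  { split; auto; intros u Hu v Hv; apply Ht; left; apply Ht in Hu as [Hu| ->]; auto.
    apply HB in Hu as (Tu & b & Hb); apply HB; split; [exact (proj2 HT u Tu v Hv)|].
    destruct (acts_set Hb (is_set_of_mem Z Hv)) as (_ & H & _).
    destruct (H v Hv) as (z & _ & Hz); eauto. }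
  exists y, t, Y', f; split; auto; split; [apply Ht; auto|]; split; auto; split; [|split].
  - intros u v R Au; apply Hf in R as (_ & _ & [R|[-> ->]]); auto using acts_atom.
  - intros u v R Su; apply Hf in R as (Hu & _ & R).
    assert (E : forall w z, w ∈ u -> (related f w z <-> acts p w z)).
    { intros w z Hw; rewrite Hf' by exact (proj2 Tt u Hu w Hw).
      split; auto; intros [H|[-> ->]]; auto.
      assert (Bx : x ∈ B).
      { apply Ht in Hu as [Hu| ->]; auto.
        apply HB in Hu as (Tu & b & Hb).
        destruct (acts_set Hb Su) as (_ & H & _); destruct (H x Hw) as (z & _ & Hz).
        apply HB; eauto. }
      apply HB in Bx as (_ & b & Hb); rewrite <- (Ey b Hb); exact Hb. }
    assert (is_set v /\ forall z, z ∈ v <-> ∃ w ∈ u, acts p w z) as [Sv Hv].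
    { destruct R as [R|[-> ->]]; auto.
      destruct (acts_set R Su) as (Sv & T1 & I); split; auto; intro z; split; auto.
      intros (w & Hw & Hz); destruct (T1 w Hw) as (z' & Hz' & H').
      rewrite (acts_unique Hp Hz H'); exact Hz'. }
    split; auto; intro z; rewrite Hv; split; intros (w & Hw & H); exists w; split; auto;
      apply (E w z Hw); exact H.
  - apply Hf'; [apply Ht; auto|right; auto].
Qed.

(** The value of the action, arbitrary when there is none. *)
Definition act p x : M := epsilon (inhabits x) (acts p x).

Lemma act_spec p x : p ∈ Sigma -> ranked x -> acts p x (act p x).
Proof. intros Hp Hx; unfold act; apply epsilon_spec; apply acts_exists; auto. Qed.

Lemma acts_iff p x y : p ∈ Sigma -> ranked x -> (acts p x y <-> y = act p x).
Proof.
  intros Hp Hx; split; [intro H|intros ->; apply act_spec; auto].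
  apply (acts_unique Hp H), act_spec; auto.
Qed.

Lemma act_atom p a b : p ∈ Sigma -> atom a -> (related p a b <-> b = act p a).
Proof.
  intros Hp Aa; pose proof (acts_atom (act_spec Hp (ranked_atom Aa)) Aa) as H.
  split; [intro R; exact (perm_fun Hp R H) | intros ->; exact H].
Qed.

Lemma atom_act_atom p a : p ∈ Sigma -> atom a -> atom (act p a).
Proof. intros Hp Aa; apply (@perm_atom_cod p a); auto; apply act_atom; auto. Qed.

Lemma ranked_act p x : p ∈ Sigma -> ranked x -> ranked (act p x).
Proof. intros Hp Hx; exact (acts_ranked_value Hp (act_spec Hp Hx)). Qed.

Lemma is_set_act p x : p ∈ Sigma -> ranked x -> is_set x -> is_set (act p x).
Proof. intros Hp Hx Sx; apply (acts_set (act_spec Hp Hx) Sx). Qed.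

Lemma mem_act_iff p x z : p ∈ Sigma -> ranked x -> is_set x ->
  (z ∈ act p x <-> ∃ w ∈ x, z = act p w).
Proof.
  intros Hp Hx Sx; destruct (acts_set (act_spec Hp Hx) Sx) as (_ & T & I); split.
  - intro Hz; destruct (I z Hz) as (w & Hw & H); exists w; split; auto.
    apply acts_iff; eauto using ranked_mem.
  - intros (w & Hw & ->); destruct (T w Hw) as (z & Hz & H).
    apply acts_iff in H as ->; eauto using ranked_mem.
Qed.

Lemma mem_act p x w : p ∈ Sigma -> ranked x -> w ∈ x -> act p w ∈ act p x.
Proof.
  intros Hp Hx Hw; apply mem_act_iff; eauto using is_set_of_mem.
Qed.

Lemma act_square_set f g f' g' x :
  f ∈ Sigma -> g ∈ Sigma -> f' ∈ Sigma -> g' ∈ Sigma -> ranked x -> is_set x ->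
  (∀ w ∈ x, act g (act f w) = act g' (act f' w)) -> act g (act f x) = act g' (act f' x).
Proof.
  intros Hf Hg Hf' Hg' Hx Sx E.
  assert (K : forall f g v, f ∈ Sigma -> g ∈ Sigma ->
      (v ∈ act g (act f x) <-> ∃ w ∈ x, v = act g (act f w))).
  { clear - Z HA HSigma Hx Sx; intros f g v Hf Hg.
    rewrite mem_act_iff by auto using ranked_act, is_set_act; split.
    - intros (u & Hu & ->); apply mem_act_iff in Hu as (w & Hw & ->); eauto.
    - intros (w & Hw & ->); exists (act f w); split; auto using mem_act. }
  apply (set_ext Z); auto using is_set_act, ranked_act.
  intro v; rewrite !K by auto; split; intros (w & Hw & ->); exists w; split; auto.
  symmetry; auto.
Qed.

(** An equality between composites of two actions need only be checked at atoms.  This one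
    lemma yields the action of compositions and inverses, and the commutation of a
    transposition with the permutations that fix its two atoms. *)
Lemma act_square f g f' g' :
  f ∈ Sigma -> g ∈ Sigma -> f' ∈ Sigma -> g' ∈ Sigma ->
  (forall a, atom a -> act g (act f a) = act g' (act f' a)) ->
  forall x, ranked x -> act g (act f x) = act g' (act f' x).
Proof.
  intros Hf Hg Hf' Hg' H.
  enough (K : forall x, ranked x -> forall y z y' z', acts f x y -> acts g y z ->
      acts f' x y' -> acts g' y' z' -> z = z').
  { intros x Hx; eapply K; eauto using act_spec, ranked_act. }
  apply (@ranked_induction (fun x => forall y z y' z', acts f x y -> acts g y z ->
      acts f' x y' -> acts g' y' z' -> z = z')); [dfn|].
  intros x Hx IH y z y' z' B C B' C'.
  apply acts_iff in B as ->, B' as ->; auto.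
  apply acts_iff in C as ->, C' as ->; auto using ranked_act.
  destruct (classic (atom x)) as [Ax|Sx]; auto.
  apply act_square_set; auto; intros w Hw; assert (ranked w) by eauto using ranked_mem.
  eapply IH; eauto using act_spec, ranked_act.
Qed.

Lemma perm_identity : exists i, i ∈ Sigma /\ forall x, ranked x -> act i x = x.
Proof.
  destruct (@bijection_exists M Z (fun x y => x = y) A A) as (i & Bi & Hi);
    try solve [dfn | intros; subst; eauto].
  exists i; assert (Hi' : i ∈ Sigma) by (apply HSigma; exact Bi); split; auto.
  enough (K : forall x, ranked x -> acts i x x).
  { intros x Hx; symmetry; apply acts_iff; auto. }
  apply (@ranked_induction (fun x => acts i x x)); [dfn|].
  intros x Hx IH; apply acts_iff; auto.
  destruct (classic (atom x)) as [Ax|Sx].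
  - apply act_atom; auto; apply Hi; split; [|split]; auto; apply HA; auto.
  - assert (E : forall w, w ∈ x -> w = act i w).
    { intros w Hw; apply acts_iff; eauto using ranked_mem. }
    apply (set_ext Z); auto using is_set_act; intro v; rewrite mem_act_iff by auto; split.
    + intro Hv; exists v; auto.
    + intros (w & Hw & ->); rewrite <- (E w Hw); auto.
Qed.

Lemma perm_comp f g : f ∈ Sigma -> g ∈ Sigma ->
  exists h, h ∈ Sigma /\ is_comp h g f /\ forall x, ranked x -> act h x = act g (act f x).
Proof.
  intros Hf Hg; pose proof (perm_bijection Hf) as Bf; pose proof (perm_bijection Hg) as Bg.
  destruct (@bijection_exists M Z (fun x z => exists y, related f x y /\ related g y z) A A)
    as (h & Bh & Hh).
  - dfn.
  - intros x Hx; apply HA in Hx.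
    exists (act g (act f x)); split; [apply HA; auto using atom_act_atom|].
    exists (act f x); split; apply act_atom; auto using atom_act_atom.
  - intros x _ z z' _ _ (y & R & S) (y' & R' & S').
    rewrite (perm_fun Hf R R') in S; exact (perm_fun Hg S S').
  - intros z Hz; destruct (bijection_surj Bg Hz) as (y & Hy).
    destruct (bijection_surj Bf (related_dom Z (proj1 Bg) Hy)) as (x & Hx).
    exists x; split; eauto; apply (related_dom Z (proj1 Bf) Hx).
  - intros z _ x x' _ _ (y & R & S) (y' & R' & S').
    rewrite (bijection_inj Z Bg S S') in R; exact (bijection_inj Z Bf R R').
  - assert (Hh' : h ∈ Sigma) by (apply HSigma; exact Bh).
    exists h; split; auto; split.
    + split; [apply Bh|]; intro t; split.
      * intro Ht; destruct (proj1 (proj2 (proj1 Bh)) t Ht) as (x & z & _ & _ & E).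
        assert (R : related h x z) by (exists t; auto).
        apply Hh in R as (_ & _ & y & R & S); exists x, y, z; auto.
      * intros (x & y & z & R & S & E); apply (is_opair_iff Z) in E as ->.
        apply (related_iff Z), Hh; split; [|split]; eauto using related_dom.
        -- apply (related_dom Z (proj1 Bf) R).
        -- apply (related_cod Z (proj1 Bg) S).
    + destruct perm_identity as (i & Hi & Ei); intros x Hx.
      rewrite <- (Ei (act h x)) by auto using ranked_act.
      (* The square with sides h, identity and f, g. *)
      apply act_square; auto; intros a Aa; rewrite Ei by auto using ranked_atom, ranked_act.
      symmetry; apply act_atom; auto; apply Hh; split; [|split].
      * apply HA; auto.
      * apply HA; auto using atom_act_atom.
      * exists (act f a); split; apply act_atom; auto using atom_act_atom.
Qed.

Lemma perm_inverse p : p ∈ Sigma ->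
  exists q, q ∈ Sigma /\ is_inverse q p /\
    (forall x, ranked x -> act q (act p x) = x) /\ (forall x, ranked x -> act p (act q x) = x).
Proof.
  intro Hp; pose proof (perm_bijection Hp) as Bp.
  destruct (@bijection_exists M Z (fun x y => related p y x) A A) as (q & Bq & Hq).
  - dfn.
  - intros x Hx; destruct (bijection_surj Bp Hx) as (y & Hy); exists y; split; auto.
    apply (related_dom Z (proj1 Bp) Hy).
  - intros x _ y y' _ _; apply (bijection_inj Z Bp).
  - intros y Hy; destruct (function_total (proj1 Bp) Hy) as (x & Hx); exists x; split; auto.
    apply (related_cod Z (proj1 Bp) Hx).
  - intros y _ x x' _ _; apply (perm_fun Hp).
  - assert (Hq' : q ∈ Sigma) by (apply HSigma; exact Bq).
    assert (Hr : forall x y, related q y x <-> related p x y).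
    { intros x y; rewrite Hq; split; [tauto|]; intro R; split; [|split]; auto.
      - apply (related_cod Z (proj1 Bp) R).
      - apply (related_dom Z (proj1 Bp) R). }
    destruct perm_identity as (i & Hi & Ei).
    exists q; split; auto; split; [|split].
    + split; [apply Bq|]; intro t; split.
      * intro Ht; destruct (proj1 (proj2 (proj1 Bq)) t Ht) as (y & x & _ & _ & E).
        exists x, y; split; auto; apply Hr; exists t; auto.
      * intros (x & y & R & E); apply (is_opair_iff Z) in E as ->.
        apply (related_iff Z), Hr, R.
    + intros x Hx; transitivity (act i (act i x)); [|rewrite !Ei; auto; rewrite Ei; auto].
      apply act_square; auto; intros a Aa; rewrite !Ei; rewrite ?Ei; auto using ranked_atom.
      symmetry; apply act_atom, Hr, act_atom; auto using atom_act_atom.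
    + intros x Hx; transitivity (act i (act i x)); [|rewrite !Ei; auto; rewrite Ei; auto].
      apply act_square; auto; intros a Aa; rewrite !Ei; rewrite ?Ei; auto using ranked_atom.
      symmetry; apply act_atom, Hr, act_atom; auto using atom_act_atom.
Qed.

Lemma act_inj p x y : p ∈ Sigma -> ranked x -> ranked y -> act p x = act p y -> x = y.
Proof.
  intros Hp Hx Hy E; destruct (perm_inverse Hp) as (q & _ & _ & H & _).
  rewrite <- (H x), <- (H y), E; auto.
Qed.

Lemma mem_act_cancel p x w : p ∈ Sigma -> ranked x -> ranked w -> act p w ∈ act p x -> w ∈ x.
Proof.
  intros Hp Hx Hw H; destruct (perm_inverse Hp) as (q & Hq & _ & E & _).
  rewrite <- (E x), <- (E w) by auto; auto using mem_act, ranked_act.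
Qed.

Lemma act_upair p x y : p ∈ Sigma -> ranked (upair Z x y) ->
  act p (upair Z x y) = upair Z (act p x) (act p y).
Proof.
  intros Hp H; apply (set_ext Z).
  - apply is_set_act; auto; apply is_set_upair.
  - apply is_set_upair.
  - intro z; rewrite mem_act_iff, mem_upair; auto using is_set_upair; split.
    + intros (w & Hw & ->); apply mem_upair in Hw as [->| ->]; auto.
    + intros [->| ->]; [exists x|exists y]; rewrite mem_upair; auto.
Qed.

Lemma ranked_upair x y : ranked (upair Z x y) -> ranked x /\ ranked y.
Proof. intro H; split; apply (ranked_mem H), mem_upair; auto. Qed.

Lemma ranked_opair x y : ranked (opair Z x y) -> ranked x /\ ranked y.
Proof. intro H; apply ranked_upair in H as [_ H]; apply ranked_upair, H. Qed.

Lemma act_opair p x y : p ∈ Sigma -> ranked (opair Z x y) ->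
  act p (opair Z x y) = opair Z (act p x) (act p y).
Proof.
  intros Hp H; unfold opair in *; rewrite act_upair by auto.
  apply ranked_upair in H as [H H']; rewrite !act_upair; auto.
Qed.

Lemma act_related p r x y : p ∈ Sigma -> ranked r ->
  related r x y -> related (act p r) (act p x) (act p y).
Proof.
  intros Hp Hr H; apply (related_iff Z) in H; apply (related_iff Z).
  rewrite <- act_opair; eauto using mem_act, ranked_mem.
Qed.

End Action.

(** * Supports *)

Section Supports.
Variable M : structure.
Hypothesis Z : is_ZFA M.
Variables A Sigma F : M.
Hypothesis HA : is_atom_set A.
Hypothesis HSigma : is_Sym Sigma A.
Hypothesis HF : is_generated_filter A Sigma F.
Implicit Types p q f g h x y z a b t w u v X Y T s : M.

Definition supports s x : Prop :=
  ∀ p ∈ Sigma, ((∀ a ∈ s, act p a = a) -> act p x = x).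

Definition finite_atoms s : Prop := is_finite s /\ subset s A.

Lemma finite_atoms_ranked s a : finite_atoms s -> a ∈ s -> ranked a.
Proof. intros [_ H] Ha; apply (ranked_atom Z), HA, H, Ha. Qed.

Lemma stab_exists x : exists K, is_stab Sigma K x.
Proof.
  destruct (@separation M Z (fun p => acts p x x) Sigma) as (K & S & H); [dfn|].
  exists K; split; auto.
Qed.

(** From right to left, the stabilizer belongs to the filter: it contains the pointwise
    stabilizer of [s], and it is a subgroup because the action respects identity, composition
    and inverses. *)
Lemma symmetric_iff x : ranked x ->
  (symmetric Sigma F x <-> exists s, finite_atoms s /\ supports s x).
Proof.
  intro Hx; destruct HF as [_ HF']; split.
  - intros (H & [_ HH] & FH); apply HF' in FH as (_ & s & Fs & As & K).
    exists s; split; [split; auto|]; intros p Hp Fix; symmetry.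
    apply (acts_iff Z HA HSigma x Hp Hx), HH, K; auto.
    intros a Ha; destruct (stab_exists a) as (L & HL); exists L; split; auto.
    apply HL; split; auto; apply (acts_iff Z HA HSigma); auto; [|symmetry; auto].
    apply (ranked_atom Z), HA, As, Ha.
  - intros (s & [Fs As] & Sup); destruct (stab_exists x) as (H & HH).
    exists H; split; auto; apply HF'.
    assert (E : forall p, p ∈ H <-> p ∈ Sigma /\ act p x = x).
    { intro p; destruct HH as [_ HH]; rewrite HH; split; intros [Hp K]; split; auto.
      - symmetry; apply (acts_iff Z HA HSigma); auto.
      - apply (acts_iff Z HA HSigma); auto. }
    split; [split; [apply HH|]; split; [|split; [|split]]|].
    + intros p Hp; apply E, Hp.
    + destruct (perm_identity Z HA HSigma) as (i & Hi & Ei); exists i; apply E; auto.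
    + intros f Hf g Hg; apply E in Hf as [Hf Ef], Hg as [Hg Eg].
      destruct (perm_comp Z HA HSigma Hf Hg) as (h & Hh & Ch & Eh); exists h; split; auto.
      apply E; split; auto; rewrite Eh, Ef; auto.
    + intros f Hf; apply E in Hf as [Hf Ef].
      destruct (perm_inverse Z HA HSigma Hf) as (g & Hg & Ig & Eg & _); exists g; split; auto.
      apply E; split; auto; rewrite <- Ef at 1; auto.
    + exists s; split; [|split]; auto; intros p Hp Fix; apply E; split; auto.
      apply Sup; auto; intros a Ha; destruct (Fix a Ha) as (K & HK & Hp').
      apply HK in Hp' as [_ Hp']; symmetry; apply (acts_iff Z HA HSigma); auto.
      apply (ranked_atom Z), HA, As, Ha.
Qed.

Lemma finite_atoms_union s s' : finite_atoms s -> finite_atoms s' ->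
  exists s'', finite_atoms s'' /\ subset s s'' /\ subset s' s''.
Proof.
  intros [Fs As] [Fs' As']; destruct (union2_exists Z s s') as (u & Su & Hu).
  exists u; split; [split|split].
  - exact (finite_union Z Fs Fs' Su Hu).
  - intros z Hz; apply Hu in Hz as [Hz|Hz]; auto.
  - intros z Hz; apply Hu; auto.
  - intros z Hz; apply Hu; auto.
Qed.

Lemma finite_atoms_empty : exists s, finite_atoms s.
Proof.
  destruct (empty_exists Z) as (o & So & Ho); exists o; split.
  - apply (finite_empty Z), Ho.
  - intros z Hz; destruct (Ho z Hz).
Qed.

(** The class of permutations that fix [s] pointwise is closed under inverses, so an inclusion
    for all of them is an equality. *)
Lemma supports_of_closed s X : ranked X -> is_set X -> finite_atoms s ->
  (∀ p ∈ Sigma, ((∀ a ∈ s, act p a = a) -> ∀ x ∈ X, act p x ∈ X)) -> supports s X.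
Proof.
  intros RX SX Hs H p Hp Fix; apply (set_ext Z); auto.
  { apply (is_set_act Z HA HSigma); auto. }
  intro z; rewrite (mem_act_iff Z HA HSigma) by auto; split.
  - intros (w & Hw & ->); auto.
  - intro Hz; destruct (perm_inverse Z HA HSigma Hp) as (q & Hq & _ & E & E').
    assert (Rz : ranked z) by exact (ranked_mem RX Hz).
    exists (act q z); split; [|rewrite E'; auto]; apply H; auto.
    intros a Ha; rewrite <- (Fix a Ha) at 1; apply E; eauto using finite_atoms_ranked.
Qed.

(** * Hereditarily symmetric objects *)

Notation hs := (hereditarily_symmetric Sigma F).

Lemma trans_closure_exists T x : is_transitive T -> subset x T ->
  exists t, is_trans_closure t x /\ subset t T.
Proof.
  intros HT Hx.
  destruct (@separation M Z (fun z => forall u, is_transitive u -> subset x u -> z ∈ u) T)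
    as (t & St & Ht); [dfn|].
  exists t; split; [split; [split|split]|]; auto.
  - intros u Hu v Hv; apply Ht in Hu as [Tu Hu]; apply Ht; split; [exact (proj2 HT u Tu v Hv)|].
    intros w Hw Xw; exact (proj2 Hw u (Hu w Hw Xw) v Hv).
  - intros z Hz; apply Ht; auto.
  - intros u Hu Xu z Hz; apply Ht in Hz as [_ Hz]; auto.
  - intros z Hz; apply Ht in Hz as [Hz _]; auto.
Qed.

Lemma trans_closure_unique t t' x : is_trans_closure t x -> is_trans_closure t' x -> t = t'.
Proof.
  intros (T & S & Min) (T' & S' & Min'); apply (set_ext Z); [apply T|apply T'|].
  intro z; split; intro H; [apply (Min t')|apply (Min' t)]; auto.
Qed.

(** This form, with x itself a member of the transitive set, makes heredity immediate. *)
Lemma hs_iff x :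
  hs x <-> exists T, is_transitive T /\ x ∈ T /\ ∀ y ∈ T, symmetric Sigma F y.
Proof.
  split.
  - intros (Sx & t & ([St Tt] & Xt & _) & H).
    destruct (adjoin_exists Z t x) as (T & ST & HT); exists T; split; [split|split]; auto.
    + intros u Hu v Hv; apply HT; left; apply HT in Hu as [Hu| ->]; auto; exact (Tt u Hu v Hv).
    + apply HT; auto.
    + intros y Hy; apply HT in Hy as [Hy| ->]; auto.
  - intros (T & HT & Hx & H); split; auto.
    destruct (@trans_closure_exists T x) as (t & Ht & Tt); auto.
    + intros z Hz; exact (proj2 HT x Hx z Hz).
    + exists t; split; auto.
Qed.

Lemma hs_ranked x : hs x -> ranked x.
Proof. intro H; apply hs_iff in H as (T & HT & Hx & _); exists T; auto. Qed.

Lemma hs_mem x y : hs x -> y ∈ x -> hs y.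
Proof.
  intros H Hy; apply hs_iff in H as (T & HT & Hx & H); apply hs_iff; exists T.
  split; [|split]; auto; exact (proj2 HT x Hx y Hy).
Qed.

Lemma hs_support x : hs x -> exists s, finite_atoms s /\ supports s x.
Proof. intro H; apply symmetric_iff; [apply hs_ranked, H | apply H]. Qed.

(** Replacement collects the transitive closures of the elements of [X]; their union together
    with [X] is transitive. *)
Lemma hs_elements_transitive_cover X : (∀ x ∈ X, hs x) ->
  exists U, is_transitive U /\ subset X U /\ ∀ y ∈ U, symmetric Sigma F y.
Proof.
  intros H.
  destruct (@replacement M Z (fun x t => is_trans_closure t x) X) as (Y & SY & HY).
  { unfold is_trans_closure; dfn. }
  { intros x _ t t'; apply trans_closure_unique. }
  destruct (zfa_union Z Y) as (C & SC & HC), (union2_exists Z X C) as (U & SU & HU).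
  assert (E : forall x, x ∈ X -> exists t, is_trans_closure t x /\ subset t C /\
      ∀ y ∈ t, symmetric Sigma F y).
  { intros x Hx; destruct (H x Hx) as (_ & t & Ht & St); exists t; split; [|split]; auto.
    intros y Hy; apply HC; exists t; split; auto; apply HY; eauto. }
  assert (E' : forall y, y ∈ C -> exists x t, x ∈ X /\ is_trans_closure t x /\ y ∈ t).
  { intros y Hy; apply HC in Hy as (t & Ht & Hy); apply HY in Ht as (x & Hx & Ht).
    exists x, t; auto. }
  exists U; split; [split|split]; auto.
  - intros u Hu v Hv; apply HU; right; apply HU in Hu as [Hu|Hu].
    + destruct (E u Hu) as (t & (_ & S & _) & TC & _); auto.
    + destruct (E' u Hu) as (x & t & Hx & Ht & Ut).
      apply HC; exists t; split; [apply HY; eauto|]; exact (proj2 (proj1 Ht) u Ut v Hv).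
  - intros x Hx; apply HU; auto.
  - intros y Hy; apply HU in Hy as [Hy|Hy]; [apply H, Hy|].
    destruct (E' y Hy) as (x & t & Hx & Ht & Yt).
    destruct (E x Hx) as (t' & Ht' & _ & S); rewrite (trans_closure_unique Ht Ht') in Yt; auto.
Qed.

(** The criterion by which every set below is shown to belong to the permutation model. *)
Lemma hs_intro s X : is_set X -> (∀ x ∈ X, hs x) -> finite_atoms s ->
  (∀ p ∈ Sigma, ((∀ a ∈ s, act p a = a) -> ∀ x ∈ X, act p x ∈ X)) -> hs X.
Proof.
  intros SX H Hs K; destruct (hs_elements_transitive_cover H) as (U & [SU TU] & XU & SymU).
  destruct (adjoin_exists Z U X) as (T & ST & HT).
  assert (TT : is_transitive T).
  { split; auto; intros u Hu v Hv; apply HT; left; apply HT in Hu as [Hu| ->]; auto.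
    exact (TU u Hu v Hv). }
  assert (XT : X ∈ T) by (apply HT; auto).
  apply hs_iff; exists T; split; [|split]; auto.
  intros y Hy; apply HT in Hy as [Hy| ->]; auto.
  assert (RX : ranked X) by (exists T; auto).
  apply symmetric_iff; auto; exists s; split; auto; apply supports_of_closed; auto.
Qed.

Lemma singleton_atoms a : atom a -> finite_atoms (upair Z a a).
Proof.
  intro Ha; destruct (empty_exists Z) as (o & So & Ho); split.
  - apply (@finite_adjoin M Z o _ a).
    + apply (finite_empty Z), Ho.
    + apply is_set_upair.
    + intro z; rewrite mem_upair; split; [intros [->| ->]; auto|].
      intros [H|H]; [destruct (Ho z H)|auto].
  - intros z Hz; apply mem_upair in Hz as [->| ->]; apply HA, Ha.
Qed.

Lemma hs_atom a : atom a -> hs a.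
Proof.
  intro Ha; apply hs_iff; exists (upair Z a a); split; [split|split].
  - apply is_set_upair.
  - intros u Hu v Hv; apply mem_upair in Hu as [->| ->]; destruct (zfa_atom Z Ha Hv).
  - apply mem_upair; auto.
  - intros y Hy; apply symmetric_iff.
    + apply mem_upair in Hy as [->| ->]; apply (ranked_atom Z Ha).
    + exists (upair Z a a); split; [apply singleton_atoms; auto|].
      intros p _ Fix; exact (Fix y Hy).
Qed.

Lemma hs_upair x y : hs x -> hs y -> hs (upair Z x y).
Proof.
  intros Hx Hy.
  destruct (hs_support Hx) as (s & Fs & Ss), (hs_support Hy) as (s' & Fs' & Ss').
  destruct (finite_atoms_union Fs Fs') as (u & Fu & Su & Su').
  apply (@hs_intro u); auto using is_set_upair.
  - intros z Hz; apply mem_upair in Hz as [->| ->]; auto.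
  - intros p Hp Fix z Hz; apply mem_upair in Hz as [->| ->]; apply mem_upair.
    + left; apply Ss; auto.
    + right; apply Ss'; auto.
Qed.

Lemma hs_opair x y : hs x -> hs y -> hs (opair Z x y).
Proof. intros Hx Hy; apply hs_upair; apply hs_upair; auto. Qed.

End Supports.

(** * Absoluteness for transitive substructures *)

Section Absoluteness.
Variable M : structure.
Hypothesis Z : is_ZFA M.
Variable P : M -> Prop.
Hypothesis P_mem : forall x y, P x -> y ∈ x -> P y.

Definition substructure : structure :=
  {| carrier := {x : M | P x};
     mem := fun x y => proj1_sig x ∈ proj1_sig y;
     atom := fun x => atom (proj1_sig x) |}.

Implicit Types x y z p r f g h : substructure.

Definition val x : M := proj1_sig x.

(** Distinct objects of the substructure are distinct in [M]; this is proof irrelevance. *)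
Lemma val_inj x y : val x = val y -> x = y.
Proof.
  destruct x as [x Hx], y as [y Hy]; unfold val; simpl; intros ->.
  rewrite (proof_irrelevance _ Hx Hy); reflexivity.
Qed.

(** Transitivity of the substructure, from which absoluteness follows: an object of [M] that
    belongs to an object of the substructure is itself one. *)
Lemma val_lift (z : M) y : z ∈ val y -> exists z' : substructure, val z' = z /\ z' ∈ y.
Proof.
  intro H; assert (Pz : P z) by exact (P_mem (proj2_sig y) H).
  exists (exist P z Pz); split; auto.
Qed.

Lemma is_upair_abs p x y : is_upair p x y <-> is_upair (val p) (val x) (val y).
Proof.
  split; intros [S H]; split; auto.
  - intro z; split.
    + intro Hz; destruct (val_lift Hz) as (z' & <- & Hz'); apply H in Hz' as [->| ->]; auto.
    + intros [->| ->]; [apply (H x)|apply (H y)]; auto.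
  - intro z; split.
    + intro Hz; apply (H (val z)) in Hz as [E|E]; apply val_inj in E; auto.
    + intros [->| ->]; apply (H (val _)); auto.
Qed.

Lemma is_opair_abs p x y : is_opair p x y <-> is_opair (val p) (val x) (val y).
Proof.
  split.
  - intros (s & d & A & B & C); exists (val s), (val d).
    apply is_upair_abs in A, B, C; auto.
  - intros (s & d & A & B & C).
    destruct (@val_lift s p) as (s' & <- & _); [apply C; auto|].
    destruct (@val_lift d p) as (d' & <- & _); [apply C; auto|].
    exists s', d'; rewrite !is_upair_abs; auto.
Qed.

Lemma is_opair_unique p x y x' y' :
  is_opair p x y -> is_opair p x' y' -> x = x' /\ y = y'.
Proof.
  rewrite !is_opair_abs, !(is_opair_iff Z); intros -> E; apply opair_inj in E as [E E'].
  split; apply val_inj; auto.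
Qed.

Lemma is_opair_lift p (x y : M) : is_opair (val p) x y ->
  exists x' y', val x' = x /\ val y' = y /\ is_opair p x' y'.
Proof.
  intros (s & d & A & B & C).
  destruct (@val_lift d p) as (d' & <- & _); [apply C; auto|].
  destruct (@val_lift x d') as (x' & <- & _); [apply B; auto|].
  destruct (@val_lift y d') as (y' & <- & _); [apply B; auto|].
  exists x', y'; split; [|split]; auto; apply is_opair_abs; exists s, (val d'); auto.
Qed.

Lemma related_abs r x y : related r x y <-> related (val r) (val x) (val y).
Proof.
  split.
  - intros (p & A & B); exists (val p); split; auto; apply is_opair_abs; auto.
  - intros (p & A & B); destruct (val_lift B) as (p' & <- & B').
    exists p'; split; auto; apply is_opair_abs; auto.
Qed.

Lemma related_lift r (x y : M) : related (val r) x y ->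
  exists x' y', val x' = x /\ val y' = y /\ related r x' y'.
Proof.
  intros (p & A & B); destruct (val_lift B) as (p' & <- & B').
  destruct (is_opair_lift A) as (x' & y' & <- & <- & C); exists x', y'.
  split; [|split]; auto; exists p'; auto.
Qed.

Lemma is_function_abs f x y : is_function f x y <-> is_function (val f) (val x) (val y).
Proof.
  split; intros (S & H & T); (split; [exact S|split]).
  - intros t Ht; destruct (val_lift Ht) as (t' & <- & Ht').
    destruct (H t' Ht') as (a & b & Ha & Hb & E); exists (val a), (val b).
    apply is_opair_abs in E; auto.
  - intros a Ha; destruct (val_lift Ha) as (a' & <- & Ha').
    destruct (T a' Ha') as (b & R & U); exists (val b); split; [apply related_abs, R|].
    intros c Rc; destruct (related_lift Rc) as (a1 & c' & E & <- & Rc').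
    apply val_inj in E as ->; rewrite (U c' Rc'); auto.
  - intros t Ht; destruct (H (val t) Ht) as (a & b & Ha & Hb & E).
    destruct (is_opair_lift E) as (a' & b' & <- & <- & E'); exists a', b'; auto.
  - intros a Ha; destruct (T (val a) Ha) as (b & R & U).
    destruct (related_lift R) as (a' & b' & E & <- & R').
    apply val_inj in E as ->; exists b'; split; auto.
    intros c Rc; apply val_inj, U, related_abs, Rc.
Qed.

Lemma is_bijection_abs f x y : is_bijection f x y <-> is_bijection (val f) (val x) (val y).
Proof.
  unfold is_bijection; rewrite is_function_abs.
  split; intros [Ff H]; split; auto; intros b Hb.
  - destruct (val_lift Hb) as (b' & <- & Hb').
    destruct (H b' Hb') as (a & R & U); exists (val a); split; [apply related_abs, R|].
    intros c Rc; destruct (related_lift Rc) as (c' & b1 & <- & E & Rc').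
    apply val_inj in E as ->; rewrite (U c' Rc'); auto.
  - destruct (H (val b) Hb) as (a & R & U).
    destruct (related_lift R) as (a' & b' & <- & E & R').
    apply val_inj in E as ->; exists a'; split; auto.
    intros c Rc; apply val_inj, U, related_abs, Rc.
Qed.

Lemma op_value_abs (op : substructure) x y z :
  op_value op x y z <-> op_value (val op) (val x) (val y) (val z).
Proof.
  split.
  - intros (p & A & B); exists (val p); rewrite <- is_opair_abs, <- related_abs; auto.
  - intros (p & A & B); destruct (related_lift B) as (p' & z' & <- & E & B').
    apply val_inj in E as ->; exists p'; rewrite is_opair_abs; auto.
Qed.

Lemma is_automorphism_abs f V E :
  is_automorphism f V E <-> is_automorphism (val f) (val V) (val E).
Proof.
  unfold is_automorphism; rewrite is_bijection_abs; split; intros [B H]; split; auto.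
  - intros x Hx y Hy x' y' Rx Ry.
    destruct (related_lift Rx) as (u & u' & <- & <- & Rx').
    destruct (related_lift Ry) as (v & v' & <- & <- & Ry').
    rewrite <- !related_abs; auto.
  - intros x Hx y Hy x' y' Rx Ry; rewrite !related_abs; apply H; auto;
      apply related_abs; auto.
Qed.

End Absoluteness.

(** * The group of finite sets of atoms *)

Section FiniteSets.
Variable M : structure.
Hypothesis Z : is_ZFA M.
Variables A Sigma F : M.
Hypothesis HA : is_atom_set A.
Hypothesis HSigma : is_Sym Sigma A.
Hypothesis HF : is_generated_filter A Sigma F.
Implicit Types p q f g h x y z a b t w u v X Y T s : M.

Notation hs := (hereditarily_symmetric Sigma F).

Definition symdiff x y z : Prop :=
  is_set z /\ forall u, u ∈ z <-> (u ∈ x /\ ~ u ∈ y) \/ (u ∈ y /\ ~ u ∈ x).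

Lemma symdiff_exists x y : exists z, symdiff x y z.
Proof.
  destruct (union2_exists Z x y) as (w & _ & Hw).
  destruct (@separation M Z (fun u => (u ∈ x /\ ~ u ∈ y) \/ (u ∈ y /\ ~ u ∈ x)) w)
    as (z & Sz & Hz); [dfn|].
  exists z; split; auto; intro u; rewrite Hz, Hw; tauto.
Qed.

Lemma symdiff_unique x y z z' : symdiff x y z -> symdiff x y z' -> z = z'.
Proof. intros [S H] [S' H']; apply (set_ext Z); auto; intro u; rewrite H, H'; tauto. Qed.

Lemma symdiff_comm x y z : symdiff x y z -> symdiff y x z.
Proof. intros [S H]; split; auto; intro u; rewrite H; tauto. Qed.

Lemma symdiff_assoc x y z xy yz r :
  symdiff x y xy -> symdiff y z yz -> (symdiff xy z r <-> symdiff x yz r).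
Proof.
  intros [_ H] [_ K].
  assert (E : forall u, (u ∈ xy /\ ~ u ∈ z) \/ (u ∈ z /\ ~ u ∈ xy) <->
                   (u ∈ x /\ ~ u ∈ yz) \/ (u ∈ yz /\ ~ u ∈ x)).
  { intro u; rewrite H, K; destruct (classic (u ∈ x)), (classic (u ∈ y)), (classic (u ∈ z));
      tauto. }
  unfold symdiff; split; intros [S L]; split; auto; intro u; rewrite L, E; tauto.
Qed.

Lemma symdiff_act p x y z : p ∈ Sigma -> is_set x -> is_set y ->
  ranked x -> ranked y -> ranked z -> symdiff x y z -> symdiff (act p x) (act p y) (act p z).
Proof.
  intros Hp Sx Sy Rx Ry Rz [Sz H]; split; [apply (is_set_act Z HA HSigma); auto|].
  pose proof (fun x w => mem_act_cancel Z HA HSigma (x := x) (w := w) Hp) as C.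
  intro u; rewrite !(mem_act_iff Z HA HSigma) by auto; split.
  - intros (w & Hw & ->); rewrite <- !(mem_act_iff Z HA HSigma) by auto.
    assert (ranked w) by exact (ranked_mem Rz Hw).
    apply H in Hw as [[X Y]|[X Y]]; [left|right];
      (split; [apply (mem_act Z HA HSigma); auto|]); eauto.
  - intros [[(w & Hw & ->) N]|[(w & Hw & ->) N]]; exists w; split; auto; apply H.
    + left; split; auto; intro Hw'; apply N; eauto.
    + right; split; auto; intro Hw'; apply N; eauto.
Qed.

Lemma finite_atoms_act p x : p ∈ Sigma -> is_set x -> finite_atoms A x ->
  finite_atoms A (act p x).
Proof.
  intros Hp Sx [Fx Ax]; pose proof (is_set_of_mem Z) as SM.
  assert (At : forall w, w ∈ x -> atom w) by (intros w Hw; apply HA, Ax, Hw).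
  assert (Rx : ranked x).
  { destruct (adjoin_exists Z A x) as (T & ST & HT); exists T; split; [split|]; auto.
    - intros u Hu v Hv; apply HT in Hu as [Hu| ->]; [|apply HT; auto].
      apply HA in Hu; destruct (zfa_atom Z Hu Hv).
    - apply HT; auto. }
  split.
  - apply (@finite_image M Z (fun u v => related p u v) x); auto.
    + dfn.
    + intros u v v'; apply (perm_fun Z HSigma Hp).
    + apply (is_set_act Z HA HSigma); auto.
    + intro z; rewrite (mem_act_iff Z HA HSigma) by auto.
      split; intros (w & Hw & K); exists w; split; auto;
        apply (act_atom Z HA HSigma); auto.
  - intros z Hz; apply (mem_act_iff Z HA HSigma) in Hz as (w & Hw & ->); auto.
    apply HA, (atom_act_atom Z HA HSigma); auto.
Qed.

Lemma hs_finite_atoms x : is_set x -> finite_atoms A x -> hs x.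
Proof.
  intros Sx Fx; apply (hs_intro Z HA HSigma HF (s := x)); auto.
  - intros w Hw; apply (hs_atom Z HA HSigma HF), HA, Fx, Hw.
  - intros p _ Fix w Hw; rewrite Fix; auto.
Qed.

Lemma symdiff_finite_atoms x y z : finite_atoms A x -> finite_atoms A y -> symdiff x y z ->
  finite_atoms A z.
Proof.
  intros Fx Fy [Sz Hz]; destruct (finite_atoms_union Z Fx Fy) as (u & [Fu Au] & Su & Su').
  assert (subset z u) by (intros w Hw; apply Hz in Hw as [[Hw _]|[Hw _]]; auto).
  split; [exact (finite_subset Z Fu Sz H)|intros w Hw; auto].
Qed.

(** The group lives in the permutation model because all of its constituents are
    fixed by every permutation of the atoms. *)
Lemma finite_sets_group :
  exists G PG op, hs G /\ hs PG /\ hs op /\ is_set G /\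
    (forall x, x ∈ G <-> is_set x /\ finite_atoms A x) /\
    is_product PG G G /\ is_function op PG G /\
    forall x y z, op_value op x y z <-> x ∈ G /\ y ∈ G /\ z ∈ G /\ symdiff x y z.
Proof.
  destruct (zfa_power Z A) as (Pow & _ & HPow).
  destruct (@separation M Z (fun x => is_finite x) Pow) as (G & SG & HG'); [dfn|].
  assert (HG : forall x, x ∈ G <-> is_set x /\ finite_atoms A x).
  { intro x; rewrite HG', HPow; unfold finite_atoms; tauto. }
  clear HG' HPow.
  destruct (@relation_exists M Z (fun x y => x = x) G G) as (PG & SP & HP'); [dfn|].
  assert (HP : forall t, t ∈ PG <-> exists x y, x ∈ G /\ y ∈ G /\ t = opair Z x y).
  { intro t; rewrite HP'; split; intros (x & y & H); exists x, y; intuition. }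
  clear HP'.
  destruct (@function_exists M Z (fun t z => exists x y, is_opair t x y /\ symdiff x y z) PG G)
    as (op & Fop & Hop).
  { unfold symdiff; dfn. }
  { intros t Ht; apply HP in Ht as (x & y & Hx & Hy & ->).
    destruct (symdiff_exists x y) as (z & Hz); exists z; split.
    - apply HG in Hx, Hy; apply HG; split; [apply Hz|].
      apply (@symdiff_finite_atoms x y z); tauto.
    - exists x, y; auto using opair_spec. }
  { intros t _ z z' _ _ (x & y & E & H) (x' & y' & E' & H').
    apply (is_opair_iff Z) in E, E'; rewrite E in E'; apply opair_inj in E' as [<- <-].
    exact (symdiff_unique H H'). }
  destruct (finite_atoms_empty Z A) as (s & Hs).
  assert (EG : forall x, x ∈ G -> hs x).
  { intros x Hx; apply HG in Hx; apply hs_finite_atoms; tauto. }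
  assert (EP : forall t, t ∈ PG -> hs t).
  { intros t Ht; apply HP in Ht as (x & y & Hx & Hy & ->).
    apply (hs_opair Z HA HSigma HF); auto. }
  assert (CG : forall p, p ∈ Sigma -> ∀ x ∈ G, act p x ∈ G).
  { intros p Hp x Hx; pose proof (hs_ranked Z (EG x Hx)) as Rx; apply HG in Hx as [Sx Fx].
    apply HG; split; [apply (is_set_act Z HA HSigma)|apply finite_atoms_act]; auto. }
  assert (CP : forall p, p ∈ Sigma -> ∀ t ∈ PG, act p t ∈ PG).
  { intros p Hp t Ht; pose proof (hs_ranked Z (EP t Ht)) as Rt.
    apply HP in Ht as (x & y & Hx & Hy & ->); apply HP.
    exists (act p x), (act p y); split; [|split]; auto.
    apply (act_opair HA HSigma); auto. }
  assert (Eop : forall t, t ∈ op -> exists x y z, x ∈ G /\ y ∈ G /\ z ∈ G /\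
      symdiff x y z /\ t = opair Z (opair Z x y) z).
  { intros t Ht; destruct Fop as (_ & K & _); destruct (K t Ht) as (u & z & _ & _ & E).
    apply (is_opair_iff Z) in E as ->; apply (related_iff Z), Hop in Ht.
    destruct Ht as (Hu & Hz & x & y & E & H); apply (is_opair_iff Z) in E as ->.
    apply HP in Hu as (x' & y' & Hx & Hy & E); apply opair_inj in E as [<- <-].
    exists x, y, z; auto 6. }
  assert (Mop : forall x y z, x ∈ G -> y ∈ G -> z ∈ G -> symdiff x y z ->
      opair Z (opair Z x y) z ∈ op).
  { intros x y z Hx Hy Hz H; apply (related_iff Z), Hop; split; [apply HP; eauto|].
    split; auto; exists x, y; auto using opair_spec. }
  assert (HOP : forall t, t ∈ op -> hs t).
  { intros t Ht; apply Eop in Ht as (x & y & z & Hx & Hy & Hz & _ & ->).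
    apply (hs_opair Z HA HSigma HF); auto; apply (hs_opair Z HA HSigma HF); auto. }
  exists G, PG, op; split; [|split; [|split]].
  - apply (hs_intro Z HA HSigma HF (s := s)); auto.
  - apply (hs_intro Z HA HSigma HF (s := s)); auto.
  - apply (hs_intro Z HA HSigma HF (s := s)); auto; [apply Fop|].
    intros p Hp _ t Ht; pose proof (hs_ranked Z (HOP t Ht)) as Rt.
    apply Eop in Ht as (x & y & z & Hx & Hy & Hz & H & ->).
    rewrite (act_opair HA HSigma), (act_opair HA HSigma); auto.
    + apply Mop; auto; apply symdiff_act; auto; try (apply HG; assumption);
        apply (hs_ranked Z (Sigma:=Sigma) (F:=F)); auto.
    + apply ranked_opair in Rt; tauto.
  - split; auto; split; auto; split; [|split]; auto.
    + split; auto; intro t; rewrite HP; split; intros (x & y & Hx & Hy & E);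
        exists x, y; split; auto; split; auto; apply (is_opair_iff Z); auto.
    + intros x y z; split.
      * intros (u & E & R); apply (is_opair_iff Z) in E as ->.
        apply (related_iff Z), Eop in R as (x' & y' & z' & Hx & Hy & Hz & H & E).
        apply opair_inj in E as [E <-]; apply opair_inj in E as [<- <-]; auto.
      * intros (Hx & Hy & Hz & H); exists (opair Z x y); split; [apply opair_spec|].
        apply (related_iff Z), Mop; auto.
Qed.

Notation N := (permutation_model Sigma F).

Lemma finite_sets_group_in_model :
  exists (g G op : N), is_group g /\ is_opair g G op /\
    (forall x, x ∈ proj1_sig G <-> is_set x /\ finite_atoms A x) /\
    forall x y z : M, op_value (proj1_sig op) x y z <->
      x ∈ proj1_sig G /\ y ∈ proj1_sig G /\ z ∈ proj1_sig G /\ symdiff x y z.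
Proof.
  destruct finite_sets_group
    as (G & PG & op & hsG & hsP & hsop & SG & HG & HP & Fop & Hop).
  set (G' := exist hs G hsG : N); set (P' := exist hs PG hsP : N).
  set (op' := exist hs op hsop : N).
  set (g' := exist hs (opair Z G op) (hs_opair Z HA HSigma HF hsG hsop) : N).
  assert (Eg : is_opair g' G' op').
  { apply (is_opair_abs (hs_mem Z (Sigma:=Sigma) (F:=F))); apply opair_spec. }
  assert (Eop : forall x y z : N, op_value op' x y z <->
      val x ∈ G /\ val y ∈ G /\ val z ∈ G /\ symdiff (val x) (val y) (val z)).
  { intros x y z; rewrite (op_value_abs (hs_mem Z (Sigma:=Sigma) (F:=F))); apply Hop. }
  assert (Lift : forall x, x ∈ G -> exists x' : N, val x' = x).
  { intros x Hx; exists (exist hs x (hs_mem Z (Sigma:=Sigma) (F:=F) hsG Hx)); reflexivity. }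
  assert (Closed : forall x y z, x ∈ G -> y ∈ G -> symdiff x y z -> z ∈ G).
  { intros x y z Hx Hy H; apply HG in Hx, Hy; apply HG; split; [apply H|].
    apply (symdiff_finite_atoms (x := x) (y := y)); tauto. }
  exists g', G', op'; split; [|split; [|split]]; auto.
  exists G', op'; split; [|split; [|split; [|split]]]; auto.
  - exists P'; split; [split; [apply HP|]|].
    + intro t; destruct HP as [_ HP]; change (val t ∈ PG <-> exists a b : N,
        val a ∈ G /\ val b ∈ G /\ is_opair t a b); rewrite HP; split.
      * intros (x & y & Hx & Hy & E).
        destruct (Lift x Hx) as (x' & <-), (Lift y Hy) as (y' & <-).
        exists x', y'; split; auto; split; auto.
        apply (is_opair_abs (hs_mem Z (Sigma:=Sigma) (F:=F))); auto.
      * intros (x & y & Hx & Hy & E); exists (val x), (val y); split; auto; split; auto.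
        apply (is_opair_abs (hs_mem Z (Sigma:=Sigma) (F:=F))); auto.
    + apply (is_function_abs (hs_mem Z (Sigma:=Sigma) (F:=F))); auto.
  - intros x Hx y Hy z Hz xy yz r; rewrite !Eop.
    intros (_ & _ & Hxy & E) (_ & _ & Hyz & E').
    rewrite (symdiff_assoc (val r) E E'); tauto.
  - destruct (empty_exists Z) as (o & So & Ho).
    assert (Go : o ∈ G).
    { apply HG; split; auto; split; [apply (finite_empty Z); auto|].
      intros z Hz; destruct (Ho z Hz). }
    destruct (Lift o Go) as (o' & Eo); exists o'; split; [red; simpl; fold (val o'); congruence|].
    split.
    + intros x Hx; change (val x ∈ G) in Hx.
      assert (Sx : is_set (val x)) by (apply HG, Hx).
      rewrite !Eop, Eo; split; (split; [|split; [|split; [|split]]]; auto); intro u;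
        pose proof (Ho u); tauto.
    + intros x Hx; change (val x ∈ G) in Hx; exists x; split; auto.
      rewrite Eop, Eo; split; (split; [|split; [|split; [|split]]]; auto); intro u;
        pose proof (Ho u); tauto.
Qed.

End FiniteSets.

(** * Transpositions as automorphisms *)

Section Transpositions.
Variable M : structure.
Hypothesis Z : is_ZFA M.
Variables A Sigma F : M.
Hypothesis HA : is_atom_set A.
Hypothesis HSigma : is_Sym Sigma A.
Hypothesis HF : is_generated_filter A Sigma F.
Implicit Types p q f g h x y z a b c t w u v X Y T s : M.

Notation hs := (hereditarily_symmetric Sigma F).
Notation N := (permutation_model Sigma F).

Definition transposition p a b : Prop :=
  p ∈ Sigma /\ act p a = b /\ act p b = a /\
  forall c, atom c -> c <> a -> c <> b -> act p c = c.

Lemma transposition_exists a b : atom a -> atom b -> exists p, transposition p a b.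
Proof.
  intros Aa Ab; apply HA in Aa, Ab.
  set (R := fun x y => x = a /\ y = b \/ x = b /\ y = a \/ x <> a /\ x <> b /\ y = x).
  assert (Sym : forall x y, R x y -> R y x).
  { unfold R; intros x y; destruct (classic (x = a)), (classic (x = b)),
      (classic (y = a)), (classic (y = b)); intuition congruence. }
  assert (Fun : forall x y y', R x y -> R x y' -> y = y').
  { unfold R; intros x y y' H H'; intuition congruence. }
  assert (Tot : ∀ x ∈ A, ∃ y ∈ A, R x y).
  { intros x Hx; unfold R; destruct (classic (x = a)); [exists b; auto|].
    destruct (classic (x = b)); [exists a; auto|exists x; auto 6]. }
  destruct (@bijection_exists M Z R A A) as (p & Bp & Rp); eauto.
  { unfold R; dfn. }
  { intros y Hy; destruct (Tot y Hy) as (x & Hx & H); eauto. }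
  assert (Hp : p ∈ Sigma) by (apply HSigma; exact Bp).
  assert (E : forall x y, x ∈ A -> y ∈ A -> R x y -> act p x = y).
  { intros x y Hx Hy H; symmetry; apply (act_atom Z HA HSigma _ Hp); [apply HA, Hx|].
    apply Rp; auto. }
  exists p; split; [|split; [|split]]; auto.
  - apply E; auto; left; auto.
  - apply E; auto; right; left; auto.
  - intros c Ac Na Nb; apply HA in Ac; apply E; auto; right; right; auto.
Qed.

(** Both composites agree at a and b, and at any other atom [c] the transposition moves neither
    [c] nor its image under [q]. *)
Lemma transposition_commute p a b q : atom a -> atom b -> transposition p a b ->
  q ∈ Sigma -> act q a = a -> act q b = b ->
  forall x, ranked x -> act q (act p x) = act p (act q x).
Proof.
  intros Aa Ab (Hp & Ea & Eb & Ec) Hq Fa Fb.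
  apply (act_square Z HA HSigma); auto; intros c Ac.
  assert (Inj : forall d, atom d -> act q c = act q d -> c = d).
  { intros d Ad; apply (act_inj Z HA HSigma); auto using ranked_atom. }
  destruct (classic (c = a)) as [->|Na]; [congruence|].
  destruct (classic (c = b)) as [->|Nb]; [congruence|].
  rewrite (Ec c), (Ec (act q c)); auto.
  - apply (atom_act_atom Z HA HSigma); auto.
  - intro K; apply Na, Inj; congruence.
  - intro K; apply Nb, Inj; congruence.
Qed.

Lemma transposition_fixes p a b s : finite_atoms A s -> transposition p a b ->
  ~ a ∈ s -> ~ b ∈ s -> ∀ c ∈ s, act p c = c.
Proof.
  intros [_ Hs] (_ & _ & _ & H) Na Nb c Hc; apply H; [apply HA, Hs, Hc| |]; intros ->; auto.
Qed.

(** If [q] fixes a support of [V], and a and b, then it maps [V] onto itself and commutes with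
    [p]; hence it maps the pair of x and px to that of qx and its image under [p].  So these
    atoms support the restriction of [p] to [V]. *)
Lemma transposition_restriction p a b V : atom a -> atom b -> transposition p a b ->
  hs V -> is_set V -> act p V = V ->
  exists f, hs f /\ is_bijection f V V /\ forall x y, related f x y <-> x ∈ V /\ y = act p x.
Proof.
  intros Aa Ab Tp HV SV EV; pose proof Tp as (Hp & _).
  pose proof (hs_ranked Z HV) as RV.
  assert (Rx : forall x, x ∈ V -> ranked x) by (intros x; apply (ranked_mem RV)).
  assert (VV : forall q x, q ∈ Sigma -> act q V = V -> x ∈ V -> act q x ∈ V).
  { intros q x Hq Eq Hx; rewrite <- Eq; apply (mem_act Z HA HSigma); auto. }
  destruct (@bijection_exists M Z (fun x y => acts p x y) V V) as (f & Bf & Hf).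
  - dfn.
  - intros x Hx; exists (act p x); split; auto; apply (act_spec Z HA HSigma); auto.
  - intros x _ y y' _ _; apply (acts_unique Z HSigma Hp).
  - intros y Hy; rewrite <- EV in Hy; apply (mem_act_iff Z HA HSigma) in Hy as (x & Hx & ->); auto.
    exists x; split; auto; apply (act_spec Z HA HSigma); auto.
  - intros y _ x x' Hx Hx' H H'; apply (acts_iff Z HA HSigma) in H, H'; auto.
    apply (act_inj Z HA HSigma (p := p)); auto; congruence.
  - assert (Hf' : forall x y, related f x y <-> x ∈ V /\ y = act p x).
    { intros x y; rewrite Hf; split.
      - intros (Hx & _ & H); apply (acts_iff Z HA HSigma) in H; auto.
      - intros (Hx & ->); split; [|split]; auto; apply (act_spec Z HA HSigma); auto. }
    assert (Ef : forall t, t ∈ f <-> exists x, x ∈ V /\ t = opair Z x (act p x)).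
    { intro t; split.
      - intro Ht; destruct (proj1 (proj2 (proj1 Bf)) t Ht) as (x & y & _ & _ & E).
        apply (is_opair_iff Z) in E as ->; apply (related_iff Z), Hf' in Ht as [Hx ->]; eauto.
      - intros (x & Hx & ->); apply (related_iff Z), Hf'; auto. }
    exists f; split; auto.
    destruct (hs_support Z HA HSigma HF HV) as (s & Fs & Ss).
    destruct (finite_atoms_union Z Fs (singleton_atoms Z HA Aa)) as (s1 & Fs1 & I1 & J1).
    destruct (finite_atoms_union Z Fs1 (singleton_atoms Z HA Ab)) as (s2 & Fs2 & I2 & J2).
    assert (Hop : forall t, t ∈ f -> hs t).
    { intros t Ht; apply Ef in Ht as (x & Hx & ->).
      apply (hs_opair Z HA HSigma HF); apply (hs_mem Z HV); auto. }
    apply (hs_intro Z HA HSigma HF (s := s2)); auto; [apply Bf|].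
    intros q Hq Fix t Ht; pose proof (hs_ranked Z (Hop t Ht)) as Rt.
    apply Ef in Ht as (x & Hx & ->); apply Ef; exists (act q x); split.
    + apply VV; auto; apply Ss; auto.
    + rewrite (act_opair HA HSigma) by auto; f_equal.
      apply (transposition_commute (a := a) (b := b)); auto; apply Fix.
      * apply I2, J1, mem_upair; auto.
      * apply J2, mem_upair; auto.
Qed.

Lemma act_automorphism p f V E : p ∈ Sigma -> hs V -> ranked E -> act p E = E ->
  is_bijection f V V -> (forall x y, related f x y <-> x ∈ V /\ y = act p x) ->
  is_automorphism f V E.
Proof.
  intros Hp HV RE EE Bf Hf; split; auto; intros x Hx y Hy x' y' Rx Ry.
  apply Hf in Rx as [_ ->], Ry as [_ ->]; split.
  - intro H; rewrite <- EE; apply (act_related Z HA HSigma); auto.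
  - intro H; apply (related_iff Z) in H; apply (related_iff Z).
    assert (R : ranked (opair Z x y)).
    { apply (hs_ranked Z (Sigma := Sigma) (F := F)),
        (hs_opair Z HA HSigma HF); apply (hs_mem Z HV); auto. }
    apply (mem_act_cancel Z HA HSigma (p := p)); auto.
    rewrite (act_opair HA HSigma), EE; auto.
Qed.

(** ** Composition in the automorphism group of the permutation model *)

Lemma aut_op_comp (a V E H op g f h : N) :
  is_aut_group a V E -> is_opair a H op -> op_value op g f h -> is_comp h g f.
Proof.
  intros (H' & op' & E' & _ & _ & _ & K) Ea (p & Ep & t & Et & Ht).
  destruct (is_opair_unique Z (hs_mem Z (F := F)) Ea E') as [<- <-].
  apply K in Ht as (g' & f' & h' & p' & _ & _ & C & Ep' & Et').
  destruct (is_opair_unique Z (hs_mem Z (F := F)) Et Et') as [<- <-].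
  destruct (is_opair_unique Z (hs_mem Z (F := F)) Ep Ep') as [<- <-].
  exact C.
Qed.

(** The composites are compared through the pair of x and qpx.  To infer from the first
    composition that it belongs to [h], it has to be an object of the model. *)
Lemma comp_commute (h f g V : N) p q :
  p ∈ Sigma -> q ∈ Sigma -> act p (proj1_sig V) = proj1_sig V ->
  act q (proj1_sig V) = proj1_sig V ->
  (forall x y, related (proj1_sig f) x y <-> x ∈ proj1_sig V /\ y = act p x) ->
  (forall x y, related (proj1_sig g) x y <-> x ∈ proj1_sig V /\ y = act q x) ->
  is_comp h g f -> is_comp h f g ->
  ∀ x ∈ proj1_sig V, act q (act p x) = act p (act q x).
Proof.
  intros Hp Hq Vp Vq Ef Eg [_ C] [_ C'] x Hx.
  pose proof (hs_ranked Z (proj2_sig V)) as RV.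
  pose proof (related_abs (hs_mem Z (Sigma := Sigma) (F := F))) as RA.
  assert (Hpx : act p x ∈ proj1_sig V) by (rewrite <- Vp; apply (mem_act Z HA HSigma); auto).
  assert (Hqpx : act q (act p x) ∈ proj1_sig V)
    by (rewrite <- Vq; apply (mem_act Z HA HSigma); auto).
  pose proof (fun y (Hy : y ∈ proj1_sig V) => hs_mem Z (proj2_sig V) Hy) as L.
  set (x' := exist hs x (L _ Hx) : N); set (y' := exist hs (act p x) (L _ Hpx) : N).
  set (z' := exist hs _ (L _ Hqpx) : N).
  set (t := exist hs (opair Z x (act q (act p x)))
              (hs_opair Z HA HSigma HF (L _ Hx) (L _ Hqpx)) : N).
  assert (Et : is_opair t x' z').
  { apply (is_opair_abs (hs_mem Z (F := F))), opair_spec. }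
  assert (Ht : t ∈ h).
  { apply C; exists x', y', z'; split; [|split]; auto; apply RA.
    - apply Ef; auto.
    - apply Eg; auto. }
  apply C' in Ht as (x1 & y1 & z1 & R & S & Et').
  destruct (is_opair_unique Z (hs_mem Z (F := F)) Et Et') as [<- <-].
  apply RA in R; apply RA in S; apply Eg in R as [_ R]; apply Ef in S as [_ S].
  unfold val in *; simpl in *; congruence.
Qed.

End Transpositions.

Theorem mainTheorem4 (M : structure) (A Sigma F : M) :
  is_ZFA M ->
  is_atom_set A ->
  countably_infinite A ->
  is_Sym Sigma A ->
  is_generated_filter A Sigma F ->
  ~ Frucht (permutation_model Sigma F).
Proof.
  intros Z HA Inf HSigma HF Fr.
  set (N := permutation_model Sigma F) in *.
  set (hs := hereditarily_symmetric Sigma F).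
  assert (Lm : forall x y : M, hs x -> y ∈ x -> hs y) by (intros x y; apply (hs_mem Z)).
  destruct (finite_sets_group_in_model Z HA HSigma HF) as (g & G & op & Gg & Eg & HG & Hop).
  fold N in g, G, op, Gg, Eg.
  destruct (Fr g Gg) as (Gamma & V & E & a0 & (_ & SV & _) & Aut & Iso).
  destruct Iso as (G1 & op1 & H & opH & phi & Eg1 & Ea & Bphi & Hom).
  destruct (is_opair_unique Z Lm Eg Eg1) as [<- <-]; clear Eg1.
  pose proof Aut as (H1 & op1 & Ea1 & _ & HH & _).
  destruct (is_opair_unique Z Lm Ea Ea1) as [<- <-]; clear Ea1.
  assert (RA : forall r x y : N, related r x y <-> related (val r) (val x) (val y))
    by exact (related_abs Lm).
  (* A common finite support of the graph and the isomorphism, and three new atoms. *)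
  destruct (hs_support Z HA HSigma HF (proj2_sig V)) as (sV & FV & SupV).
  destruct (hs_support Z HA HSigma HF (proj2_sig E)) as (sE & FE & SupE).
  destruct (hs_support Z HA HSigma HF (proj2_sig phi)) as (sphi & Fphi & Supphi).
  destruct (finite_atoms_union Z FV FE) as (s1 & F1 & V1 & E1).
  destruct (finite_atoms_union Z F1 Fphi) as (s & Fs & S1 & Sphi).
  destruct (countably_infinite_fresh Z Inf (proj1 Fs)) as (a & Aa & Na).
  destruct (finite_adjoin_exists Z a (proj1 Fs)) as (sa & _ & Fsa & Hsa).
  destruct (countably_infinite_fresh Z Inf Fsa) as (b & Ab & Nb).
  destruct (finite_adjoin_exists Z b Fsa) as (sb & _ & Fsb & Hsb).
  destruct (countably_infinite_fresh Z Inf Fsb) as (c & Ac & Nc).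
  rewrite Hsa in Nb; rewrite Hsb, Hsa in Nc.
  apply HA in Aa, Ab, Ac.
  destruct (transposition_exists Z HA HSigma Aa Ab) as (p & Tp).
  destruct (transposition_exists Z HA HSigma Ab Ac) as (q & Tq).
  pose proof Tp as (Hp & pa & _ & pc); pose proof Tq as (Hq & qb & _ & qa).
  assert (Fp : ∀ x ∈ s, act p x = x).
  { apply (transposition_fixes HA Fs Tp); tauto. }
  assert (Fq : ∀ x ∈ s, act q x = x).
  { apply (transposition_fixes HA Fs Tq); tauto. }
  assert (Fix : forall r, r ∈ Sigma -> (∀ x ∈ s, act r x = x) ->
      act r (val V) = val V /\ act r (val E) = val E /\ act r (val phi) = val phi).
  { intros r Hr Hfix; split; [|split]; [apply SupV|apply SupE|apply Supphi]; auto. }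
  destruct (Fix p Hp Fp) as (pV & pE & pphi), (Fix q Hq Fq) as (qV & qE & qphi).
  assert (Ind : forall r x y, atom x -> atom y -> transposition Sigma r x y ->
      act r (val V) = val V -> act r (val E) = val E ->
      exists f : N, f ∈ H /\
        forall u v, related (val f) u v <-> u ∈ val V /\ v = act r u).
  { intros r x y Ax Ay Tr rV rE.
    destruct (transposition_restriction Z HA HSigma HF Ax Ay Tr (proj2_sig V) SV rV)
      as (f & hsf & Bf & Hf).
    exists (exist hs f hsf : N); split; [|exact Hf].
    apply HH, (is_automorphism_abs Lm).
    apply (act_automorphism Z HA HSigma HF (p := r)); auto; [apply Tr|apply (proj2_sig V)|].
    apply (hs_ranked Z (proj2_sig E)). }
  destruct (Ind p a b Aa Ab Tp pV pE) as (tp & Htp & Etp).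
  destruct (Ind q b c Ab Ac Tq qV qE) as (tq & Htq & Etq); clear Ind.
  (* Their preimages under phi commute. *)
  assert (Comm : ∀ x ∈ val V, act q (act p x) = act p (act q x)).
  { apply (is_bijection_abs Lm) in Bphi.
    assert (Pre : forall h : N, h ∈ H -> exists x : N, x ∈ G /\ related phi x h).
    { intros h Hh; destruct (bijection_surj Bphi Hh) as (x & Rx).
      destruct (val_lift Lm (related_dom Z (proj1 Bphi) Rx)) as (x' & <- & Hx').
      exists x'; split; auto; apply RA, Rx. }
    destruct (Pre tp Htp) as (x & Hx & Rx), (Pre tq Htq) as (y & Hy & Ry).
    destruct (symdiff_exists Z (val x) (val y)) as (z & Hz).
    assert (Gz : z ∈ val G).
    { apply HG in Hx, Hy; apply HG; split; [apply Hz|].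
      apply (symdiff_finite_atoms Z (x := val x) (y := val y)); tauto. }
    destruct (val_lift Lm Gz) as (z' & <- & Gz').
    destruct (function_total (proj1 Bphi) Gz) as (h & Rh).
    destruct (val_lift Lm (related_cod Z (proj1 Bphi) Rh)) as (h' & <- & _).
    apply RA in Rh.
    assert (O1 : op_value op x y z') by (apply (op_value_abs Lm), Hop; auto).
    assert (O2 : op_value op y x z').
    { apply (op_value_abs Lm), Hop; auto using symdiff_comm. }
    pose proof (Hom x Hx y Hy z' tp tq h' O1 Rx Ry Rh) as C1.
    pose proof (Hom y Hy x Hx z' tq tp h' O2 Ry Rx Rh) as C2.
    apply (aut_op_comp Z Aut Ea) in C1, C2.
    exact (comp_commute Z HA HSigma HF Hp Hq pV qV Etp Etq C2 C1). }
  (* So the two products act in the same way on the automorphisms, hence on G. *)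
  set (X := upair Z a a).
  assert (GX : X ∈ val G).
  { apply HG; split; [apply is_set_upair|apply (singleton_atoms Z HA Aa)]. }
  apply (is_bijection_abs Lm) in Bphi.
  destruct (function_total (proj1 Bphi) GX) as (h & Rh).
  pose proof (related_cod Z (proj1 Bphi) Rh) as Hh.
  pose proof (hs_ranked Z (Lm _ _ (proj2_sig G) GX)) as RX.
  pose proof (hs_ranked Z (Lm _ _ (proj2_sig H) Hh)) as Rh'.
  pose proof (hs_ranked Z (proj2_sig phi)) as Rphi.
  assert (Eh : act q (act p h) = act p (act q h)).
  { destruct (val_lift Lm Hh) as (h' & <- & Hh').
    apply HH, (is_automorphism_abs Lm) in Hh' as [((Sh & Kh & _) & _) _].
    apply (act_square_set Z HA HSigma); auto.
    intros t Ht; pose proof (ranked_mem Rh' Ht) as Rt.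
    destruct (Kh t Ht) as (u & v & Hu & Hv & Et); apply (is_opair_iff Z) in Et as ->.
    pose proof (fun r => act_opair (Z := Z) HA HSigma (p := r) (x := u) (y := v)) as Eo.
    assert (Ro : forall r, r ∈ Sigma -> ranked (opair Z (act r u) (act r v))).
    { intros r Hr; rewrite <- Eo by auto; apply (ranked_act Z HA HSigma); auto. }
    rewrite !Eo by auto; rewrite !(act_opair HA HSigma) by auto.
    rewrite (Comm u Hu), (Comm v Hv); reflexivity. }
  assert (Rpq : forall r x y, r ∈ Sigma -> act r (val phi) = val phi ->
      related (val phi) x y -> related (val phi) (act r x) (act r y)).
  { intros r x y Hr Er R; rewrite <- Er; apply (act_related Z HA HSigma); auto. }
  assert (EX : act q (act p X) = act p (act q X)).
  { apply (bijection_inj Z Bphi (y := act q (act p h))); [|rewrite Eh]; auto. }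
  (* But the first product sends a to c and the second one sends it to b. *)
  assert (Rb : ranked (upair Z b b)).
  { rewrite <- pa; unfold X in RX; rewrite <- (act_upair HA HSigma) by auto.
    apply (ranked_act Z HA HSigma); auto. }
  assert (qa' : act q a = a).
  { apply qa; auto; intros ->; tauto. }
  assert (E1' : act q (act p X) = upair Z c c).
  { unfold X in *; rewrite (act_upair HA HSigma (p := p)), pa by auto.
    rewrite (act_upair HA HSigma), qb by auto; reflexivity. }
  assert (E2' : act p (act q X) = upair Z b b).
  { unfold X in *; rewrite (act_upair HA HSigma (p := q)), qa' by auto.
    rewrite (act_upair HA HSigma), pa by auto; reflexivity. }
  rewrite E1', E2' in EX; apply upair_inj in EX as [[E0 _]|[E0 _]]; subst; tauto.
Qed.
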